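(* Let $\Gamma=(G,\sigma)$ be a connected signed graph on $n\geq 2$ vertices $1,\ldots,n$ and $m$ edges $e_1,\ldots,e_m$ with incidence matrix $N$ and Moore–Penrose inverse $N^\dagger$ (rows indexed by edges, columns by vertices). \begin{enumerate} \item[(a)] If $\Gamma$ is balanced, then \[(N^\dagger)_{ij}=\frac{1}{\tau(\Gamma)}\sum_{T\in\mathcal S(\Gamma),\ e_i\in T}(N_T^\dagger)_{ij},\] where for a spanning tree $T$ containing $e_i$, \[(N_T^\dagger)_{ij}=\frac{w(e_i)\,\mathrm{sgn}(P_{e_i-j})}{n}\begin{cases}|T_h(e_i)| & \text{if } j\in T_t(e_i),\\ -\sigma(e_i)|T_t(e_i)| & \text{if } j\in T_h(e_i),\end{cases}\] with the path $P_{e_i-j}$ taken in $T$. \item[(b)] If $\Gamma$ is unbalanced, then \[(N^\dagger)_{ij}=\frac{1}{\sum_{H\in\mathcal{TU}_n(\Gamma)}4^{c(H)}}\sum_{H\in\mathcal{TU}_n(\Gamma),\ e_i\in H}4^{c(H)}\,(N_H^{-1})_{ij},\] where, if $e_i$ lies in the component $U=U^H_r$ of $H$ with cycle $C=C^H_r$: $(N_H^{-1})_{ij}=0$ if $j\notin V(U)$, and for $j\in V(U)$, \[(N_H^{-1})_{ij}=w(e_i)\begin{cases}\tfrac12\mathrm{sgn}(P_{e_i^t-j}) & \text{if } e_i\in C,\\ 0 & \text{if } e_i\notin C \text{ and } j\in U\setminus e_i[C],\\ -\mathrm{sgn}(P_{e_i-j}) & \text{if } e_i \text{ positive}, e_i\notin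 E(C),\ j\notin U\setminus e_i[C],\ j\in U_h(e_i),\\ \mathrm{sgn}(P_{e_i-j}) & \text{otherwise.}\end{cases}\] \end{enumerate}
   Context: Signed graph $\Gamma=(G,\sigma)$: simple graph $G$ with $\sigma:E\to\{-1,1\}$; $e$ positive if $\sigma(e)=1$, negative if $\sigma(e)=-1$. $\mathrm{sgn}(P)$ is the product of $\sigma$ over the edges of a path $P$ (1 if empty). A cycle is balanced if it has an even number of negative edges; $\Gamma$ is balanced if all cycles are balanced, otherwise unbalanced. An incidence matrix $N=[n_{k\ell}]$ is an $n\times m$ matrix (rows = vertices, columns = edges) such that for $e_\ell=\{i,j\}$ column $\ell$ has exactly two nonzero entries $n_{i\ell},n_{j\ell}\in\{\pm1\}$, with $n_{i\ell}=n_{j\ell}$ if $e_\ell$ negative and $n_{i\ell}=-n_{j\ell}$ if positive. Head/tail: a positive edge $\{l,m\}$ with $n_{l\ell}=1,n_{m\ell}=-1$ has tail $l$, head $m$; a negative edge $\{l,m\}$ with $l<m$ has tail $l$, head $m$. $w(e_\ell)=-1$ if $e_\ell$ is negative with both nonzero entries of column $\ell$ equal to $-1$, else $w(e_\ell)=1$. $\mathcal S(\Gamma)$ is the set of spanning trees, $\tau(\Gamma)=|\mathcal S(\Gamma)|$. For a tree $T\ni e_i$, $T_h(e_i)$, $T_t(e_i)$ are the components of $T\setminus e_i$ containing the head and tail of $e_i$, $|\cdot|$ is the number of vertices, and $P_{e_i-j}$ is the shortest path (in the relevant subgraph) between vertex $j$ and edge $e_i$ not containing $e_i$. $\mathcal{TU}_n(\Gamma)$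 is the set of spanning subgraphs $H$ of $\Gamma$ with exactly $n$ edges each of whose components is a tree or an unbalanced unicyclic graph; $c(H)$ is the number of its unbalanced unicyclic components $U^H_1,\ldots,U^H_{c(H)}$ with cycles $C^H_1,\ldots,C^H_{c(H)}$. For a unicyclic $U$ with cycle $C$ and $e_i\notin C$: $U\setminus e_i[C]$ is the component of $U\setminus e_i$ containing $C$, $U_h(e_i)$ the component of $U\setminus e_i$ containing the head of $e_i$. For $e_i\in C$, $e_i^t$ is its tail and $P_{e_i^t-j}$ is the path between $e_i^t$ and $j$ in the tree $U\setminus e_i$. *)

(* Defs.v *)
From HB Require Import structures.
From mathcomp Require Import all_boot all_order all_algebra.
Set Implicit Arguments.
Unset Strict Implicit.
Unset Printing Implicit Defensive.
Import Order.TTheory GRing.Theory Num.Theory.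
Local Open Scope ring_scope.

Definition penrose (R : realFieldType) (p q : nat)
    (A : 'M[R]_(p, q)) (X : 'M[R]_(q, p)) : bool :=
  [&& A *m X *m A == A, X *m A *m X == X,
      (A *m X)^T == A *m X & (X *m A)^T == X *m A].

Lemma mulmx_tr_eq0 (R : realFieldType) (p q : nat) (A : 'M[R]_(p, q)) :
  A *m A^T = 0 -> A = 0.
Proof.
move=> /matrixP A0; apply/matrixP => i j; rewrite mxE.
have := A0 i i; rewrite !mxE => /eqP; rewrite psumr_eq0; last first.
  by move=> k _; rewrite mxE -expr2 sqr_ge0.
by move/allP/(_ j (mem_index_enum _)); rewrite /= mxE mulf_eq0 orbb => /eqP.
Qed.

Lemma gram_unit (R : realFieldType) (p q : nat) (A : 'M[R]_(p, q)) :
  row_free A -> A *m A^T \in unitmx.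
Proof.
move=> fA; rewrite -row_free_unit -kermx_eq0; apply/eqP.
set K := kermx _; have K0 : K *m (A *m A^T) = 0 by exact: mulmx_ker.
have: K *m A = 0.
  by apply: mulmx_tr_eq0; rewrite trmx_mul mulmxA -(mulmxA K) K0 mul0mx.
by move/eqP; rewrite mulmx_free_eq0 // => /eqP.
Qed.

Lemma penrose_base (R : realFieldType) (p q r : nat)
    (C : 'M[R]_(p, r)) (B : 'M[R]_(r, q)) :
  C^T *m C \in unitmx -> B *m B^T \in unitmx -> exists X, penrose (C *m B) X.
Proof.
move=> uC uB.
pose X := B^T *m invmx (B *m B^T) *m (invmx (C^T *m C) *m C^T).
have AX : C *m B *m X = C *m (invmx (C^T *m C) *m C^T).
  by rewrite /X -!mulmxA (mulmxA B) (mulKVmx uB).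
have XA : X *m (C *m B) = B^T *m (invmx (B *m B^T) *m B).
  by rewrite /X -!mulmxA (mulmxA C^T) (mulKmx uC).
exists X; apply/and4P; split; apply/eqP.
- by rewrite AX -!mulmxA (mulmxA C^T) (mulKmx uC).
- by rewrite XA /X -!mulmxA (mulmxA B) (mulKVmx uB).
- by rewrite AX !trmx_mul trmx_inv trmx_mul !trmxK mulmxA.
- by rewrite XA !trmx_mul trmx_inv trmx_mul !trmxK mulmxA.
Qed.

Lemma penrose_exists (R : realFieldType) (p q : nat) (A : 'M[R]_(p, q)) :
  exists X, penrose A X.
Proof.
rewrite -(mulmx_base A); apply: penrose_base; last first.
  by apply: gram_unit; exact: row_base_free.
rewrite -{2}(trmxK (col_base A)); apply: gram_unit.
by rewrite /row_free mxrank_tr; exact: col_base_full.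
Qed.

Definition mpinv (R : realFieldType) (p q : nat) (A : 'M[R]_(p, q)) :
  'M[R]_(q, p) := xchoose (penrose_exists A).

Lemma mpinvP (R : realFieldType) (p q : nat) (A : 'M[R]_(p, q)) :
  penrose A (mpinv A).
Proof. exact: xchooseP. Qed.

Lemma mpinv_uniq (R : realFieldType) (p q : nat) (A : 'M[R]_(p, q)) X :
  penrose A X -> X = mpinv A.
Proof.
have := mpinvP A; move: (mpinv A) => Y.
case/and4P=> /eqP y1 /eqP y2 /eqP y3 /eqP y4.
case/and4P=> /eqP x1 /eqP x2 /eqP x3 /eqP x4.
have AXY : A *m X = A *m Y.
  rewrite -{1}y1 -(mulmxA _ A X) -[LHS]trmxK trmx_mul x3 y3.
  by rewrite mulmxA x1 y3.
have XYA : X *m A = Y *m A.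
  rewrite -{1}y1 -(mulmxA A) mulmxA -[LHS]trmxK trmx_mul x4 y4.
  by rewrite -mulmxA (mulmxA A) x1 y4.
by rewrite -x2 -mulmxA AXY mulmxA XYA.
Qed.

(* The inverse of a matrix whose numbers of rows and columns are equal, but
   possibly not convertible. *)
Definition sqinv (R : comUnitRingType) (p q : nat) (A : 'M[R]_(p, q)) :
  'M[R]_(q, p) := conform_mx 0 (invmx (conform_mx (0 : 'M_p) A)).

Lemma sqinvE (R : comUnitRingType) (p : nat) (A : 'M[R]_p) :
  sqinv A = invmx A.
Proof. by rewrite /sqinv !conform_mx_id. Qed.

(* A signed simple graph on the vertices 'I_n with edges labelled by 'I_m. *)
Record sgraph (n m : nat) := SGraph {
  edge : 'I_m -> {set 'I_n};
  edge_card : forall e, #|edge e| = 2;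
  edge_inj : injective edge;
  sigma : 'I_m -> int;
  sigmaP : forall e, sigma e = 1 \/ sigma e = -1 }.

Section Graph.
Variables (n m : nat) (G : sgraph n m).
Implicit Types (F H T C : {set 'I_m}) (X : {set 'I_n}) (e : 'I_m) (u v : 'I_n).

Definition adj F : rel 'I_n :=
  fun u v => [exists e in F, edge G e == [set u; v]].

Definition connected_graph : bool :=
  [forall u, forall v, connect (adj setT) u v].

(* Paths are given by their first vertex u and the sequence p of the following
   ones. *)
Definition is_path F u v (p : seq 'I_n) : bool :=
  [&& path (adj F) u p, uniq (u :: p) & last u p == v].

Definition path_edges u (p : seq 'I_n) : {set 'I_m} :=
  [set e | has (fun xy => edge G e == [set xy.1; xy.2]) (zip (u :: p) p)].

Definition sgn u (p : seq 'I_n) : int := \prod_(e in path_edges u p) sigma G e.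

(* A path in F from v to an endpoint of e, not containing e. *)
Definition path_to_edge F e v (p : seq 'I_n) : bool :=
  is_path (F :\ e) v (last v p) p && (last v p \in edge G e).

Definition shortest_to_edge F e v (p : seq 'I_n) : Prop :=
  path_to_edge F e v p /\
  forall q, path_to_edge F e v q -> (size p <= size q)%N.

Lemma shortest_to_edge_exists F e v u :
  u \in edge G e -> connect (adj (F :\ e)) v u ->
  exists p, shortest_to_edge F e v p.
Proof.
move=> ue /connectP[p0 pP0 uE].
have [p [pP up lp]] : exists p, [/\ path (adj (F :\ e)) v p, uniq (v :: p)
    & last v p = u].
  by rewrite uE; case/shortenP: pP0 => p pP up _; exists p.
have ex : exists k, [exists t : k.-tuple 'I_n, path_to_edge F e v t].
  exists (size p); apply/existsP; exists (in_tuple p).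
  by rewrite /path_to_edge /is_path /= pP lp ue eqxx !andbT; case/andP: up => ->.
case: (ex_minnP ex) => k /existsP[t tP] kmin; exists t; split=> // q qP.
rewrite size_tuple; apply: kmin; apply/existsP; exists (in_tuple q); exact: qP.
Qed.

Definition cycle_edges (c : seq 'I_n) : {set 'I_m} :=
  [set e | [exists v in c, edge G e == [set v; next c v]]].

(* C is the edge set of a cycle, i.e. of a closed sequence of k >= 3 distinct
   vertices; distinctness forces k <= n. *)
Definition is_cycle C : bool :=
  [exists k : 'I_n.+1, exists c : k.-tuple 'I_n,
    [&& (2 < k)%N, uniq c, path.cycle (adj setT) c & C == cycle_edges c]].

Definition cycles_of F : {set {set 'I_m}} :=
  [set C | is_cycle C & C \subset F].

Definition balanced_cycle C : bool := ~~ odd #|[set e in C | sigma G e == -1]|.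

Definition balanced : bool := [forall C, is_cycle C ==> balanced_cycle C].

(* In the next three definitions X and F are the vertex set and the edge set of
   a subgraph. *)
Definition connected_sub X F : bool :=
  [forall u in X, forall v in X, connect (adj F) u v].

Definition is_tree X F : bool := connected_sub X F && (cycles_of F == set0).

Definition unbalanced_unicyclic X F : bool :=
  connected_sub X F &&
  [exists C, (cycles_of F == [set C]) && ~~ balanced_cycle C].

Definition spanning_trees : {set {set 'I_m}} := [set T | is_tree setT T].

Definition tau : nat := #|spanning_trees|.

(* A spanning subgraph is given by its edge set H; [component H v] is the
   vertex set of the component of v. *)
Definition component H v : {set 'I_n} := [set u | connect (adj H) v u].

Definition components H : {set {set 'I_n}} := [set component H v | v : 'I_n].

Definition edges_in H X : {set 'I_m} := [set e in H | edge G e \subset X].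

Definition TU : {set {set 'I_m}} :=
  [set H : {set 'I_m} | (#|H| == n) &&
    [forall X in components H,
      is_tree X (edges_in H X) || unbalanced_unicyclic X (edges_in H X)]].

Definition num_unicyclic H : nat :=
  #|[set X in components H | unbalanced_unicyclic X (edges_in H X)]|.

(* Vertex set of the component of the subgraph with edge set F which contains
   the cycle C. *)
Definition component_of_cycle F C : {set 'I_n} :=
  [set v | [exists e in C, exists u in edge G e, connect (adj F) u v]].

Lemma edge_ne e : exists v, v \in edge G e.
Proof. by apply/card_gt0P; rewrite edge_card. Qed.

Definition lo e : 'I_n := [arg min_(v < xchoose (edge_ne e) in edge G e) v]%N.
Definition hi e : 'I_n := [arg max_(v > xchoose (edge_ne e) in edge G e) v]%N.

Section Incidence.
Variables (R : realFieldType) (N : 'M[R]_(n, m)).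

Definition incidence : Prop := forall e u v, edge G e = [set u; v] ->
  [/\ forall k, k \notin edge G e -> N k e = 0,
      N u e = 1 \/ N u e = -1,
      N v e = 1 \/ N v e = -1,
      sigma G e = -1 -> N u e = N v e
    & sigma G e = 1 -> N u e = - N v e].

(* Exactly one entry of a positive column is 1: it marks the tail. *)
Definition edge_tail e : 'I_n :=
  if sigma G e == 1 then (if N (lo e) e == 1 then lo e else hi e) else lo e.

Definition edge_head e : 'I_n :=
  if sigma G e == 1 then (if N (lo e) e == 1 then hi e else lo e) else hi e.

Definition weight e : R :=
  if (sigma G e == -1) && [forall v in edge G e, N v e == -1] then -1 else 1.

End Incidence.
End Graph.

(* N_H: the columns of N indexed by H, in increasing order. *)
Definition subcols (R : Type) (n m : nat) (N : 'M[R]_(n, m))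
    (H : {set 'I_m}) : 'M[R]_(n, #|H|) := colsub enum_val N.

(* The (i, j) entry of a matrix whose rows correspond, in increasing order, to
   the elements of H (0 when i is not in H). *)
Definition entry_at (R : nmodType) (n m : nat) (H : {set 'I_m})
    (A : 'M[R]_(#|H|, n)) (i : 'I_m) (j : 'I_n) : R :=
  if [pick k : 'I_#|H| | enum_val k == i] is Some k then A k j else 0.

(* Main.v *)
Require Import Defs.
From HB Require Import structures.
From mathcomp Require Import all_boot all_order all_algebra.
From mathcomp Require Import ring lra.
Set Implicit Arguments.
Unset Strict Implicit.
Unset Printing Implicit Defensive.
Import Order.TTheory GRing.Theory Num.Theory.
Local Open Scope ring_scope.

(* Call a row vector [y] dual to an edge [i] of [H] if [y N_e = 0] for the other
   edges [e] of [H] and [y N_i = 1].  In the balanced case let [s] be a switching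
   function (a sign vector with [s^T N = 0]), in the unbalanced case let [s = 0].
   Spanning trees, respectively the members of [TU], are exactly the edge sets
   [H] whose columns form a basis of the orthogonal of [s], and the rows of
   [N_H^+] are the dual vectors orthogonal to [s].  Any weighted average [X] of
   the zero-padded [N_H^+] makes [N X] the orthogonal projection along [s], so
   only the symmetry of [X N] is at stake.  The sets [i |: F] and [k |: F] have
   proportional dual vectors for [i] and [k], both annihilating [F], and their
   contributions to the entries [(i, k)] and [(k, i)] agree as soon as
   [w (k |: F) = w (i |: F) * c ^ 2], where [c] is the [i]-coordinate of [N_k] in
   the basis [i |: F].  For trees [c] is a sign; for [TU] the weight [4 ^ c(H)]
   works because a vector annihilating [F] lives on one component of [F], with
   constant absolute value.  The explicit entries are obtained by propagating a
   dual vector along paths: crossing an edge [e] multiplies it by [sigma e]. *)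

(** * Paths, components and cycles *)

(** Says that [X] is a union of components of [F]: as [[set u; v]] is unordered, each edge of [F]
    has both ends in [X] or neither. *)
Definition closed_in (n m : nat) (G : sgraph n m) (F : {set 'I_m}) (X : {set 'I_n}) :=
  forall e u v, e \in F -> edge G e = [set u; v] -> u \in X -> v \in X.

Section Paths.
Variables (n m : nat) (G : sgraph n m).
Implicit Types (F H C : {set 'I_m}) (X : {set 'I_n}) (e : 'I_m) (u v x : 'I_n).

Lemma edgeP e : exists u v, [/\ edge G e = [set u; v] & u != v].
Proof.
have /eqP/cards2P[u [v [uv ->]]] := edge_card G e.
by exists u, v.
Qed.

Lemma edge_neq e u v : edge G e = [set u; v] -> u != v.
Proof. by move=> E; have := edge_card G e; rewrite E cards2; case: (u != v). Qed.

Lemma adjP F u v : reflect (exists2 e, e \in F & edge G e = [set u; v]) (adj G F u v).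
Proof.
apply: (iffP existsP) => [[e /andP[eF /eqP E]]|[e eF E]]; exists e => //.
by rewrite eF E eqxx.
Qed.

Lemma adj_sym F : symmetric (adj G F).
Proof. by move=> u v; apply/adjP/adjP => -[e eF E]; exists e; rewrite // E setUC. Qed.

Lemma adj_connect_sym F : connect_sym (adj G F).
Proof. exact: sym_connect_sym (@adj_sym F). Qed.

Lemma adj_mono F H : F \subset H -> subrel (adj G F) (adj G H).
Proof. by move=> sFH u v /adjP[e /(subsetP sFH) eH E]; apply/adjP; exists e. Qed.

Lemma connect_mono F H : F \subset H -> subrel (connect (adj G F)) (connect (adj G H)).
Proof. by move=> /adj_mono sFH; apply: connect_sub => u v /sFH /connect1. Qed.

Lemma connect_edge F e u v : e \in F -> edge G e = [set u; v] -> connect (adj G F) u v.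
Proof. by move=> eF E; apply: connect1; apply/adjP; exists e. Qed.

Lemma connect_is_path F u v :
  connect (adj G F) u v -> exists p, is_path G F u v p.
Proof.
case/connectP => p pP ->; case/shortenP: pP => q qP uq _.
by exists q; rewrite /is_path qP uq eqxx.
Qed.

Lemma is_path_connect F u v p : is_path G F u v p -> connect (adj G F) u v.
Proof. by case/and3P => pP _ /eqP <-; apply/connectP; exists p. Qed.

(** The part of a walk before its first use of [e] avoids [e] and stops at an end of [e]. *)
Lemma connect_delete F e u v x :
  edge G e = [set u; v] -> connect (adj G F) x u ->
  connect (adj G (F :\ e)) x u \/ connect (adj G (F :\ e)) x v.
Proof.
move=> E /connectP[p]; elim: p x => [|y p IH] x /=.
  by move=> _ ->; left.
case/andP => /adjP[f fF Ef] /IH{}IH /IH{}IH.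
have [fe|fe] := eqVneq f e.
  have : x \in edge G e by rewrite -fe Ef !inE eqxx.
  by rewrite E !inE => /orP[]/eqP->; [left|right].
have xy : connect (adj G (F :\ e)) x y.
  by apply: (connect_edge (e := f)) => //; rewrite !inE fe.
by case: IH => H; [left|right]; apply: connect_trans H.
Qed.

(** Every use of [e] is rerouted along the detour from [u] to [v]. *)
Lemma connect_delete_cycle F e u v x y :
  edge G e = [set u; v] -> connect (adj G (F :\ e)) u v ->
  connect (adj G F) x y -> connect (adj G (F :\ e)) x y.
Proof.
move=> E uv; apply: connect_sub => a b /adjP[f fF Ef].
have [fe|fe] := eqVneq f e; last first.
  by apply: (connect_edge (e := f)) => //; rewrite !inE fe.
have ab := edge_neq Ef.
have : a \in [set u; v] by rewrite -E -fe Ef !inE eqxx.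
have : b \in [set u; v] by rewrite -E -fe Ef !inE eqxx orbT.
rewrite !inE => /orP[]/eqP b_ /orP[]/eqP a_; subst a b => //.
- by rewrite adj_connect_sym.
Qed.

Lemma closed_in_connect F X u v :
  closed_in G F X -> u \in X -> connect (adj G F) u v -> v \in X.
Proof.
move=> cl + /connectP[p pP ->]; elim: p u pP => //= y p IH u.
by case/andP => /adjP[e eF E] pP uX; apply: IH => //; apply: cl eF E uX.
Qed.

Lemma component_closed F w : closed_in G F (component G F w).
Proof.
move=> e u v eF E; rewrite !inE => h; apply: connect_trans h _.
exact: connect_edge eF E.
Qed.

Lemma edges_in_sub F X : edges_in G F X \subset F.
Proof. by apply/subsetP => e; rewrite inE => /andP[]. Qed.

Lemma edges_in_closed F X e u v : closed_in G F X -> e \in F ->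
  edge G e = [set u; v] -> u \in X -> e \in edges_in G F X.
Proof.
move=> cl eF E uX; rewrite inE eF E subUset !sub1set uX /=; exact: cl eF E uX.
Qed.

Lemma edges_inD1 F X e : edges_in G (F :\ e) X = edges_in G F X :\ e.
Proof. by apply/setP => f; rewrite !inE andbA. Qed.

Lemma connect_edges_in F X u v : closed_in G F X -> u \in X ->
  connect (adj G F) u v -> connect (adj G (edges_in G F X)) u v.
Proof.
move=> cl + /connectP[p pP ->]; elim: p u pP => //= y p IH u.
case/andP => /adjP[e eF E] pP uX; apply: connect_trans (IH y pP _).
  exact: connect_edge (edges_in_closed cl eF E uX) E.
exact: cl eF E uX.
Qed.

Lemma mem_component F w : w \in component G F w.
Proof. by rewrite inE connect0. Qed.

Lemma component_eq F w x : x \in component G F w -> component G F x = component G F w.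
Proof.
rewrite inE => wx; apply/setP => y; rewrite !inE.
by rewrite (same_connect (adj_connect_sym F) wx).
Qed.

Lemma component_uniq F X x : closed_in G F X -> x \in X ->
  (forall y, y \in X -> connect (adj G F) x y) -> component G F x = X.
Proof.
move=> cl xX conn; apply/setP => y; rewrite inE.
by apply/idP/idP => [|/conn //]; apply: closed_in_connect.
Qed.

Lemma components_mem F w : component G F w \in components G F.
Proof. exact: imset_f. Qed.

Lemma componentsP F X : reflect (exists w, X = component G F w) (X \in components G F).
Proof. by apply: (iffP imsetP) => [[w _ ->]|[w ->]]; exists w. Qed.

Lemma components_add_inner F k u v : edge G k = [set u; v] ->
  connect (adj G F) u v -> components G (k |: F) = components G F.
Proof.
move=> E uv; apply: eq_imset => x; apply/setP => y; rewrite !inE.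
apply/idP/idP; last exact/connect_mono/subsetUr.
have [kF|kF] := boolP (k \in F).
  by rewrite (setUidPr _) // sub1set.
rewrite -[X in connect (adj G X) u v](setU1K kF) in uv.
by move/(connect_delete_cycle E uv); rewrite setU1K.
Qed.

(** The new edge merges the components of [u] and [v] and leaves all others unchanged. *)
Lemma components_add_bridge F k u v : edge G k = [set u; v] ->
  ~~ connect (adj G F) u v -> #|components G F| = #|components G (k |: F)|.+1.
Proof.
move=> E uv; set H := k |: F; set cu := component G F u; set cv := component G F v.
have sFH : F \subset H by apply: subsetUr.
have kH : k \in H by rewrite setU11.
have uvE x : x \in edge G k -> x = u \/ x = v.
  by rewrite E !inE => /orP[]/eqP->; [left|right].
have closedX : closed_in G H (cu :|: cv).
  move=> e a b; rewrite in_setU1 => /orP[/eqP->|eF] Ee ab.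
    have : b \in edge G k by rewrite Ee !inE eqxx orbT.
    by case/uvE=> ->; rewrite inE mem_component ?orbT.
  move: ab; rewrite !in_setU => /orP[] h.
    by rewrite (component_closed eF Ee h).
  by rewrite (component_closed eF Ee h) orbT.
have compX : component G H u = cu :|: cv.
  apply: component_uniq => // [|y]; first by rewrite inE mem_component.
  rewrite inE => /orP[]; rewrite inE => /(connect_mono sFH) // vy.
  by apply: connect_trans vy; apply: connect_edge kH E.
have compO x : x \notin cu :|: cv -> component G H x = component G F x.
  move=> xX; apply: component_uniq; rewrite ?mem_component //; last first.
    by move=> y; rewrite inE => /(connect_mono sFH).
  move=> e a b; rewrite in_setU1 => /orP[/eqP->|eF] Ee; last exact: component_closed eF Ee.
  have : a \in edge G k by rewrite Ee !inE eqxx.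
  rewrite inE => /uvE[]-> xa; case/negP: xX; rewrite !inE !(adj_connect_sym _ _ x) xa //.
  by rewrite orbT.
have compsE : components G H = (cu :|: cv) |: (components G F :\ cu :\ cv).
  apply/setP => X; rewrite !inE; apply/componentsP/idP => [[x ->]|].
    have [xX|xX] := boolP (x \in cu :|: cv).
      by rewrite -{1}compX -(component_eq (x := x)) ?compX ?eqxx.
    rewrite compO // components_mem andbT; apply/orP; right.
    move: xX; rewrite inE negb_or => /andP[xu xv].
    apply/andP; split; [apply: contraNneq xv|apply: contraNneq xu] => <-; exact: mem_component.
  case/orP => [/eqP->|/and3P[Xv Xu /componentsP[x XE]]]; first by exists u.
  exists x; rewrite compO ?XE //; apply/negP; rewrite inE => /orP[]/component_eq h.
    by rewrite XE h eqxx in Xu.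
  by rewrite XE h eqxx in Xv.
have cuv : cv != cu.
  by apply: contraNneq uv => h; have := mem_component F v; rewrite -/cv h inE.
rewrite compsE cardsU1 !inE !negb_and.
(* If the union were a component of [F], then [F] would connect [u] to [v]. So one new set replaces
   two distinct old ones. *)
have -> : cu :|: cv \notin components G F.
  apply/negP => /componentsP[x /setP xE]; case/negP: uv.
  have := xE u; have := xE v; rewrite !inE !connect0 ?orbT => /esym xv /esym xu.
  by apply: connect_trans xv; rewrite adj_connect_sym.
rewrite !orbT (cardsD1 cu) components_mem (cardsD1 cv) !inE cuv components_mem.
by [].
Qed.

(** * Cycles, and paths obtained by cutting one edge *)

Lemma cycle_nonempty C : is_cycle G C -> exists e, e \in C.
Proof.
case/existsP => k /existsP[c /and4P[k2 uc cc /eqP ->]].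
case E : {1}(tval c) (size_tuple c) => [|v c'] sz; first by rewrite -sz in k2.
have vc : v \in tval c by rewrite E mem_head.
have /adjP[e _ Ee] := next_cycle cc vc.
by exists e; rewrite inE; apply/existsP; exists v; rewrite vc Ee eqxx.
Qed.

Lemma path_edges_nil u : path_edges G u [::] = set0.
Proof. by apply/setP => e; rewrite !inE. Qed.

Lemma path_edges_cons e u x p :
  edge G e = [set u; x] -> path_edges G u (x :: p) = e |: path_edges G x p.
Proof.
move=> E; apply/setP => f; rewrite !inE /=; congr (_ || _).
by rewrite -E (inj_eq (@edge_inj _ _ G)).
Qed.

Lemma path_edges_vertices u p e :
  e \in path_edges G u p -> {subset edge G e <= u :: p}.
Proof.
rewrite inE; elim: p u => //= x p IH u /orP[/eqP->|/IH sub] y.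
  by rewrite !inE => /orP[]->; rewrite ?orbT.
by move=> /sub h; rewrite in_cons h orbT.
Qed.

Lemma path_edges_sub F u p : path (adj G F) u p -> path_edges G u p \subset F.
Proof.
elim: p u => [|x p IH] u /=; first by rewrite path_edges_nil sub0set.
case/andP=> /adjP[e eF E] /IH sub; rewrite (path_edges_cons _ E).
by rewrite subUset sub1set eF.
Qed.

Lemma path_adj_edges F u p :
  path (adj G F) u p -> path (adj G (path_edges G u p)) u p.
Proof.
elim: p u => [|x p IH] u //= /andP[/adjP[e eF E] /IH pP].
rewrite (path_edges_cons _ E); apply/andP; split.
  by apply/adjP; exists e; rewrite ?setU11.
by apply: sub_path pP; apply: adj_mono; apply: subsetUr.
Qed.

(** As the vertices are distinct, only the first edge of the path meets [u], and with at least two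
    edges its other end is not the last vertex. *)
Lemma closing_edge_notin e u p :
  uniq (u :: p) -> (1 < size p)%N -> edge G e = [set u; last u p] ->
  e \notin path_edges G u p.
Proof.
case: p => [|x [|y q]] //= /and3P[ux xq _] _ E; apply/negP.
rewrite inE /= => /orP[/eqP|].
  rewrite E => /setP/(_ (last y q)); rewrite !inE eqxx orbT => /esym/orP[]/eqP h.
    by move: ux; rewrite -h in_cons mem_last orbT.
  by move: xq; rewrite -h mem_last.
move=> h; have /path_edges_vertices : e \in path_edges G x (y :: q) by rewrite inE.
by move/(_ u); rewrite E !inE eqxx => /(_ isT); rewrite -!in_cons (negPf ux).
Qed.

Lemma sigma_sq e : sigma G e * sigma G e = 1.
Proof. by case: (sigmaP G e) => ->. Qed.

Lemma prod_sigma_sq F : (\prod_(e in F) sigma G e) * (\prod_(e in F) sigma G e) = 1.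
Proof. by rewrite -big_split big1 // => e _; apply: sigma_sq. Qed.

(** [sgn] is a product over a set of edges, so a repeated edge would be counted once; [e] is new
    because [u] does not occur later. *)
Lemma sgn_cons e u x p :
  edge G e = [set u; x] -> u \notin x :: p ->
  sgn G u (x :: p) = sigma G e * sgn G x p.
Proof.
move=> E ux; rewrite /sgn (path_edges_cons _ E) big_setU1 //.
apply/negP => /path_edges_vertices /(_ u); rewrite E !inE eqxx => /(_ isT).
by rewrite -in_cons (negPf ux).
Qed.

Lemma balanced_cycleE C : balanced_cycle G C = (\prod_(e in C) sigma G e == 1).
Proof.
rewrite /balanced_cycle.
have -> : \prod_(e in C) sigma G e = (-1) ^+ #|[set e in C | sigma G e == -1]|.
  rewrite -prodr_const [RHS]big_mkcond [LHS]big_mkcond; apply: eq_bigr => e _.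
  by rewrite inE; case: (e \in C) => //=; case: (sigmaP G e) => ->.
by rewrite -signr_odd; case: (odd _).
Qed.

(** Translates the [next] description of a cycle into the [zip] description of a path followed by
    its closing edge. *)
Lemma zip_rcons_next u p : uniq (u :: p) ->
  [seq (x, next (u :: p) x) | x <- u :: p] = zip (u :: p) (rcons p u).
Proof.
move=> up; apply: (@eq_from_nth _ (u, u)).
  by rewrite size_map size_zip size_rcons minnn.
move=> k; rewrite size_map => kp; rewrite (nth_map u) // nth_zip ?size_rcons //.
congr (_, _); rewrite next_nth mem_nth // index_uniq // nth_rcons.
move: kp; rewrite ltnS leq_eqVlt => /orP[/eqP->|->] //.
by rewrite ltnn eqxx nth_default.
Qed.

Lemma zip_rcons_last (T : Type) (u w : T) p :
  zip (u :: p) (rcons p w) = rcons (zip (u :: p) p) (last u p, w).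
Proof. by elim: p u => //= x p IH u; rewrite -IH. Qed.

Lemma cycle_edges_cons e u p :
  uniq (u :: p) -> edge G e = [set u; last u p] ->
  cycle_edges G (u :: p) = e |: path_edges G u p.
Proof.
move=> up E; apply/setP => f; rewrite !inE.
transitivity (has (fun xy => edge G f == [set xy.1; xy.2])
                  [seq (x, next (u :: p) x) | x <- u :: p]).
  apply/existsP/hasP => [[x /andP[xc Ef]]|[_ /mapP[x xc ->] /= Ef]].
    by exists (x, next (u :: p) x) => //; apply/mapP; exists x.
  by exists x; rewrite xc.
rewrite zip_rcons_next // zip_rcons_last has_rcons /=.
by rewrite setUC -E (inj_eq (@edge_inj _ _ G)).
Qed.

(** A path with a single edge would be [e] itself by injectivity of [edge]; hence the closed
    sequence has at least three vertices. *)
Lemma cycle_of_path F e u v p :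
  edge G e = [set u; v] -> e \notin F -> is_path G F u v p ->
  is_cycle G (e |: path_edges G u p).
Proof.
move=> E eF /and3P[pP up /eqP lp]; subst v.
have sp : (1 < size p)%N.
  case: p pP up E => [|x [|y q]] //=.
    by move=> _ _ /edge_neq; rewrite eqxx.
  move=> /andP[/adjP[f fF Ef] _] _ E; move: eF.
  by rewrite (_ : e = f) ?fF //; apply: (@edge_inj _ _ G); rewrite E Ef.
(* Distinct vertices bound the length by [n], as the index type in [is_cycle] requires. *)
have kn : (size (u :: p) < n.+1)%N.
  by rewrite ltnS -[X in (_ <= X)%N]card_ord -(card_uniqP up) max_card.
apply/existsP; exists (Ordinal kn); apply/existsP; exists (in_tuple (u :: p)).
rewrite -(cycle_edges_cons up E); apply/and4P; split => //=.
rewrite rcons_path.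
rewrite (sub_path (adj_mono (subsetT F)) pP) /=.
by rewrite adj_sym; apply/adjP; exists e.
Qed.

Lemma cycle_split C e : is_cycle G C -> e \in C ->
  exists u v p, [/\ edge G e = [set u; v], is_path G (C :\ e) u v p
    & C = e |: path_edges G u p].
Proof.
case/existsP => k /existsP[c /and4P[k2 uc cc /eqP CE]] eC.
move: (eC); rewrite {1}CE inE => /existsP[v /andP[vc /eqP E]].
have [i q Ei] := rot_to vc.
have sz : size (v :: q) = k by rewrite -Ei size_rot size_tuple.
case: q Ei sz => [|w p] Ei sz; first by move: k2; rewrite -sz.
(* Rotating [v] to the front puts [e] between [v] and [w]; one further rotation makes [e] the
   closing edge of a path from [w] to [v]. *)
have uc2 : uniq (w :: rcons p v).
  by rewrite -rcons_cons -rot1_cons -Ei !rot_uniq.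
have E2 : edge G e = [set w; last w (rcons p v)].
  rewrite last_rcons setUC E; congr [set _; _].
  by rewrite -(next_rot i) // Ei /= eqxx.
have CE2 : C = e |: path_edges G w (rcons p v).
  rewrite -(cycle_edges_cons uc2 E2) CE; apply/setP => f; rewrite !inE.
  rewrite -rcons_cons -rot1_cons -Ei.
  apply/existsP/existsP => -[x /andP[xc Ef]]; exists x; apply/andP.
    by split; [rewrite !mem_rot | rewrite !next_rot // rot_uniq].
  by split; [rewrite !mem_rot in xc | rewrite !next_rot // rot_uniq in Ef].
exists w, v, (rcons p v); split => //; first by rewrite E2 last_rcons.
have cyc : cycle (adj G setT) (w :: rcons p v).
  by rewrite -rcons_cons -rot1_cons -Ei !rot_cycle.
have pT : path (adj G setT) w (rcons p v).
  by move: cyc; rewrite [cycle _ _]/= rcons_path => /andP[].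
apply/and3P; split; rewrite ?last_rcons //.
apply: sub_path (path_adj_edges pT); apply: adj_mono; apply/subsetP => f fp.
have en : e \notin path_edges G w (rcons p v).
  apply: closing_edge_notin => //; rewrite size_rcons ltnS.
  by case: (p) sz k2 => //= <-.
by rewrite CE2 !inE in fp *; rewrite fp orbT andbT; apply: contraNneq en => <-; rewrite inE.
Qed.

End Paths.

(** * Vectors annihilated by a set of edges *)

(** A left null vector of the columns in [F]. For an incidence matrix this means that its value is
    multiplied by [sigma G e] across each [e] in [F]. *)
Definition kills (R : realFieldType) (n m : nat) (N : 'M[R]_(n, m))
    (F : {set 'I_m}) (r : 'rV[R]_n) : Prop :=
  forall e, e \in F -> (r *m N) 0 e = 0.

Definition restrict (R : realFieldType) (n : nat) (X : {set 'I_n})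
    (r : 'rV[R]_n) : 'rV[R]_n :=
  \row_v (if v \in X then r 0 v else 0).

Section Kernel.
Variables (R : realFieldType) (n m : nat) (N : 'M[R]_(n, m)).
Implicit Types (F H : {set 'I_m}) (r y : 'rV[R]_n).

Lemma killsS F H r : F \subset H -> kills N H r -> kills N F r.
Proof. by move=> /subsetP sFH kr e /sFH /kr. Qed.

Lemma kills_comb F a b r y : kills N F r -> kills N F y -> kills N F (a *: r + b *: y).
Proof.
move=> kr ky e eF; rewrite mulmxDl -!scalemxAl.
by rewrite mxE [X in X + _]mxE [X in _ + X]mxE kr // ky // !mulr0 addr0.
Qed.

End Kernel.

(** * Propagation of values along edges, paths and cycles *)

Section Potentials.
Variables (R : realFieldType) (n m : nat) (G : sgraph n m) (N : 'M[R]_(n, m)).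
Hypothesis NI : incidence G N.
Implicit Types (F H C : {set 'I_m}) (X : {set 'I_n}) (e : 'I_m) (u v x : 'I_n).
Implicit Types (r y z : 'rV[R]_n).

Local Notation sg e := ((sigma G e)%:~R : R).

Lemma sg_sq e : sg e * sg e = 1.
Proof. by rewrite -intrM sigma_sq. Qed.

Lemma mul_edge r e u v : edge G e = [set u; v] ->
  (r *m N) 0 e = r 0 u * N u e + r 0 v * N v e.
Proof.
move=> E; have uv := edge_neq E; have [N0 _ _ _ _] := NI E.
rewrite mxE (bigD1 u) //= (bigD1 v) 1?eq_sym //= big1 ?addr0 // => k /andP[ku kv].
by rewrite N0 ?mulr0 // E !inE negb_or ku.
Qed.

Lemma incidence_sq e u v : edge G e = [set u; v] -> N u e * N u e = 1.
Proof. by move=> /NI[_ [] -> _ _ _]; rewrite ?mulrNN mulr1. Qed.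

Lemma incidence_sg e u v : edge G e = [set u; v] -> N v e = - sg e * N u e.
Proof.
move=> /NI[_ _ _ Nn Np]; case: (sigmaP G e) => s; rewrite s.
  by rewrite Np // mulN1r opprK.
by rewrite Nn // rmorphN1 opprK mul1r.
Qed.

Lemma mul_edge_sg r e u v : edge G e = [set u; v] ->
  (r *m N) 0 e = N u e * (r 0 u - sg e * r 0 v).
Proof. by move=> E; rewrite (mul_edge _ E) (incidence_sg E); ring. Qed.

Lemma kills_edge r e u v : edge G e = [set u; v] ->
  (r *m N) 0 e = 0 <-> r 0 u = sg e * r 0 v.
Proof.
move=> E; rewrite (mul_edge_sg _ E); split=> [/eqP|->]; last by rewrite subrr mulr0.
rewrite mulf_eq0 subr_eq0 => /orP[/eqP N0|/eqP //].
by have /eqP := incidence_sq E; rewrite N0 mul0r eq_sym oner_eq0.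
Qed.

Lemma kills_path F r u v p : kills N F r -> is_path G F u v p ->
  r 0 v = (sgn G u p)%:~R * r 0 u.
Proof.
move=> kr /and3P[pP up /eqP <-]; elim: p u pP up => [|x p IH] u.
  by rewrite /sgn path_edges_nil big_set0 mul1r.
move=> /= /andP[/adjP[e eF E] pP] /andP[ux up].
rewrite (IH _ pP up) (sgn_cons E ux) intrM.
have /(kills_edge _ E) -> := kr _ eF.
transitivity ((sgn G x p)%:~R * (sg e * sg e) * r 0 x); last by ring.
by rewrite sg_sq mulr1.
Qed.

Lemma sgn_sq u p : ((sgn G u p)%:~R : R) * (sgn G u p)%:~R = 1.
Proof. by rewrite -intrM prod_sigma_sq. Qed.

Lemma kills_connect_sq F r u v : kills N F r -> connect (adj G F) u v ->
  r 0 v * r 0 v = r 0 u * r 0 u.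
Proof.
move=> kr /connect_is_path[p /(kills_path kr) ->].
transitivity ((sgn G u p)%:~R * (sgn G u p)%:~R * (r 0 u * r 0 u)); first by ring.
by rewrite sgn_sq mul1r.
Qed.

Lemma kills_connect0 F r u v : kills N F r -> connect (adj G F) u v ->
  r 0 u = 0 -> r 0 v = 0.
Proof.
move=> kr uv r0; have /eqP := kills_connect_sq kr uv.
by rewrite r0 mul0r mulf_eq0 orbb => /eqP.
Qed.

(** Each edge of [F] has both ends in [X] or neither, so its equation is kept or becomes trivial. *)
Lemma kills_restrict F X r : closed_in G F X ->
  kills N (edges_in G F X) r -> kills N F (restrict X r).
Proof.
move=> cl kr e eF; have [u [v [E uv]]] := edgeP G e.
apply/(kills_edge _ E); rewrite !mxE.
have vu : (v \in X) = (u \in X).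
  by apply/idP/idP; apply: (cl e) => //; rewrite E setUC.
rewrite vu; case: ifP => uX; rewrite ?mulr0 //; apply/(kills_edge _ E)/kr.
by rewrite inE eF E subUset !sub1set vu uX.
Qed.

Lemma kills_component F w r :
  kills N F r -> kills N F (restrict (component G F w) r).
Proof.
move=> kr; apply: kills_restrict; first exact: component_closed.
by apply: killsS kr; apply: edges_in_sub.
Qed.

(** Propagation along the rest of the cycle contributes the product of the other signs, which is the
    full product times the sign of [e]. *)
Lemma kills_cycle_edge C e u v r : is_cycle G C -> e \in C ->
  edge G e = [set u; v] -> kills N (C :\ e) r ->
  r 0 u = (\prod_(f in C) sigma G f)%:~R * (sg e * r 0 v).
Proof.
move=> cC eC E kr; have [a [b [p [Ea pP CE]]]] := cycle_split cC eC.
have ep : e \notin path_edges G a p.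
  by case/and3P: (pP) => /path_edges_sub /subsetP s _ _; apply/negP => /s; rewrite !inE eqxx.
rewrite CE big_setU1 //= -/(sgn G a p) intrM.
have Eb := kills_path kr pP.
(* [cycle_split] picks its own orientation of [e], so the relation is needed in both directions. *)
have key : r 0 a = sg e * (sgn G a p)%:~R * (sg e * r 0 b).
  rewrite Eb; transitivity ((sg e * sg e) * ((sgn G a p)%:~R * (sgn G a p)%:~R) * r 0 a).
    by rewrite sg_sq sgn_sq !mul1r.
  by ring.
have key2 : r 0 b = sg e * (sgn G a p)%:~R * (sg e * r 0 a).
  rewrite Eb; transitivity ((sg e * sg e) * ((sgn G a p)%:~R) * r 0 a).
    by rewrite sg_sq !mul1r.
  by ring.
have uv := edge_neq E.
have : u \in [set a; b] by rewrite -Ea E !inE eqxx.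
have : v \in [set a; b] by rewrite -Ea E !inE eqxx orbT.
rewrite !inE => /orP[]/eqP v_ /orP[]/eqP u_; subst u v => //.
- by rewrite eqxx in uv.
- by rewrite eqxx in uv.
Qed.

Lemma kills_balanced_cycle C e r : is_cycle G C -> balanced_cycle G C -> e \in C ->
  kills N (C :\ e) r -> (r *m N) 0 e = 0.
Proof.
move=> cC; rewrite balanced_cycleE => /eqP bC eC kr.
have [u [v [E uv]]] := edgeP G e.
by apply/(kills_edge _ E); rewrite (kills_cycle_edge cC eC E kr) bC mul1r.
Qed.

Lemma prod_sigma_unbalanced C :
  ~~ balanced_cycle G C -> \prod_(f in C) sigma G f = -1.
Proof.
rewrite balanced_cycleE => /negPf bC; apply/eqP.
have /eqP := prod_sigma_sq G C; rewrite -expr2 sqrf_eq1 bC //.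
Qed.

(** One turn around the cycle negates the value, which must therefore be zero. *)
Lemma kills_unbalanced_cycle C F e v r : is_cycle G C -> ~~ balanced_cycle G C ->
  C \subset F -> kills N F r -> e \in C -> v \in edge G e -> r 0 v = 0.
Proof.
move=> cC bC sCF kr eC ve.
have [u E] : exists u, edge G e = [set v; u].
  have [a [b [E _]]] := edgeP G e; move: ve; rewrite E !inE => /orP[]/eqP->.
    by exists b.
  by exists a; rewrite setUC.
have kC := killsS sCF kr.
have := kills_cycle_edge cC eC E (killsS (subD1set C e) kC).
have /(kills_edge _ E) <- := kC _ eC.
by rewrite prod_sigma_unbalanced // rmorphN1 mulN1r; lra.
Qed.

(** Existence of a switching function, by induction on the number of edges. An edge that closes a
    cycle is consistent by balance; an edge between two components is made consistent by negating
    the function on one of them. *)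
Lemma potential_exists F :
  (forall C, C \in cycles_of G F -> balanced_cycle G C) ->
  exists2 z : 'rV[R]_n, forall v, z 0 v * z 0 v = 1 & kills N F z.
Proof.
move: {2}#|F| (leqnn #|F|) => k; elim: k F => [|k IH] F.
  rewrite leqn0 cards_eq0 => /eqP-> _; exists (const_mx 1).
    by move=> v; rewrite mxE mulr1.
  by move=> e; rewrite inE.
move=> Fk bF; have [->|[e eF]] := set_0Vmem F.
  exists (const_mx 1) => [v|e]; [by rewrite mxE mulr1 | by rewrite inE].
have sF : F :\ e \subset F by apply: subD1set.
have [|C|z z1 kz] := IH (F :\ e).
- by move: Fk; rewrite (cardsD1 e) eF ltnS.
- by rewrite inE => /andP[cC sC]; apply: bF; rewrite inE cC (subset_trans sC).
have [u [v [E uv]]] := edgeP G e.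
have split_kills y : kills N (F :\ e) y -> y 0 u = sg e * y 0 v -> kills N F y.
  move=> ky y0 f fF; have [->|fe] := eqVneq f e; first exact/(kills_edge _ E).
  by apply: ky; rewrite !inE fe.
have [cuv|cuv] := boolP (connect (adj G (F :\ e)) u v).
  have [p pP] := connect_is_path cuv.
  have ef : e \notin F :\ e by rewrite !inE eqxx.
  have cC := cycle_of_path E ef pP.
  have sp : path_edges G u p \subset F :\ e.
    by case/and3P: pP => /path_edges_sub.
  exists z => //; apply: split_kills => //; apply/(kills_edge _ E).
  apply: (kills_balanced_cycle cC) => //.
  - by apply: bF; rewrite inE cC subUset sub1set eF (subset_trans sp).
  - by rewrite setU11.
  - apply: killsS kz; apply: subset_trans sp; apply/subsetP => f.
    by rewrite in_setD1 in_setU1 => /andP[/negPf->].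
have [zu|zu] := eqVneq (z 0 u) (sg e * z 0 v).
  by exists z => //; apply: split_kills.
have zu' : z 0 u = - (sg e * z 0 v).
  apply/eqP; have : z 0 u ^+ 2 == (sg e * z 0 v) ^+ 2.
    by rewrite !expr2 mulrACA sg_sq !z1 mulr1.
  by rewrite eqf_sqr (negPf zu).
(* Subtracting twice the restriction negates [z] on the component of [u], which does not contain
   [v]. *)
pose z' := 1 *: z + (-2) *: restrict (component G (F :\ e) u) z.
have z'E x : z' 0 x = if x \in component G (F :\ e) u then - z 0 x else z 0 x.
  by rewrite !mxE; case: ifP => _; ring.
exists z' => [x|].
  by rewrite z'E; case: ifP; rewrite ?mulrNN z1.
apply: split_kills; first by apply: kills_comb => //; apply: kills_component.
by rewrite !z'E !inE connect0 (negPf cuv) zu' opprK.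
Qed.

End Potentials.

(** * Dual bases and averages *)

(* [Y] holds the dual basis of the columns of [N] indexed by [H], which are
   supposed to span the orthogonal of [s]; its rows outside [H] are zero. *)
Definition dual (R : realFieldType) (n m : nat) (N : 'M[R]_(n, m)) (s : 'cV[R]_n)
    (H : {set 'I_m}) (Y : 'M[R]_(m, n)) : Prop :=
  [/\ forall i e, i \in H -> e \in H -> (Y *m N) i e = (i == e)%:R,
      forall i j, i \notin H -> Y i j = 0,
      Y *m s = 0
    & forall r : 'rV_n, kills N H r -> r *m s = 0 -> r = 0].

Lemma mulmx1_swap (R : comUnitRingType) (p q : nat) (A : 'M[R]_(p, q)) (B : 'M[R]_(q, p)) :
  p = q -> A *m B = 1%:M -> B *m A = 1%:M.
Proof. by move=> pq; subst q; apply: mulmx1C. Qed.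

Lemma sqinv_uniq (R : comUnitRingType) (p q : nat) (A : 'M[R]_(p, q)) (B : 'M[R]_(q, p)) :
  p = q -> A *m B = 1%:M -> sqinv A = B.
Proof.
move=> pq; subst q => AB; rewrite sqinvE.
have [uA _] := mulmx1_unit AB.
by rewrite -[LHS]mulmx1 -AB mulKmx.
Qed.

Section DualBases.
Variables (R : realFieldType) (n m : nat) (N : 'M[R]_(n, m)).
Implicit Types (F H : {set 'I_m}) (s : 'cV[R]_n) (Y : 'M[R]_(m, n)).

Lemma row_mulE p (Y : 'M[R]_(p, n)) i e : (row i Y *m N) 0 e = (Y *m N) i e.
Proof. by rewrite -row_mul mxE. Qed.

Lemma dual_kills s H Y i : dual N s H Y -> i \in H -> kills N (H :\ i) (row i Y).
Proof.
move=> [Y1 _ _ _] iH e; rewrite !inE => /andP[ei eH].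
by rewrite row_mulE Y1 // eq_sym (negPf ei).
Qed.

Lemma dual_diag s H Y i : dual N s H Y -> i \in H -> (row i Y *m N) 0 i = 1.
Proof. by move=> [Y1 _ _ _] iH; rewrite row_mulE Y1 // eqxx. Qed.

(** The orthogonal projection along [s]. For [s = 0] the scalar factor is the inverse of zero, which
    is zero, and the identity results. *)
Definition orth_proj s : 'M[R]_n := 1%:M - ((s^T *m s) 0 0)^-1 *: (s *m s^T).

Lemma orth_proj_tr s : (orth_proj s)^T = orth_proj s.
Proof. by rewrite /orth_proj linearB linearZ /= trmx_mul trmxK trmx1. Qed.

Lemma mul_orth_proj s p (A : 'M[R]_(n, p)) : s^T *m A = 0 -> orth_proj s *m A = A.
Proof.
by move=> sA; rewrite mulmxBl mul1mx -scalemxAl -mulmxA sA mulmx0 scaler0 subr0.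
Qed.

Lemma orth_proj_mul s p (A : 'M[R]_(p, n)) : A *m s = 0 -> A *m orth_proj s = A.
Proof.
by move=> sA; rewrite mulmxBr mulmx1 -scalemxAr mulmxA sA mul0mx scaler0 subr0.
Qed.

Lemma orth_proj_ker s : orth_proj s *m s = 0.
Proof.
rewrite mulmxBl mul1mx -scalemxAl -mulmxA.
have sE := mx11_scalar (s^T *m s).
set c := (s^T *m s) 0 0 in sE *; rewrite sE mul_mx_scalar.
(* Over a real field a zero norm forces [s = 0]. *)
have [c0|c0] := eqVneq c 0; last by rewrite scalerA mulVf // scale1r subrr.
have : s^T = 0.
  by apply: mulmx_tr_eq0; rewrite trmxK sE c0 raddf0.
by move/(congr1 trmx); rewrite trmxK trmx0 => ->; rewrite scaler0 scaler0 subrr.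
Qed.

Lemma orth_proj0 : orth_proj 0 = 1%:M.
Proof. by rewrite /orth_proj mul0mx scaler0 subr0. Qed.

(** Each row of the difference kills [H] and is orthogonal to [s], hence vanishes by the last clause
    of [dual]. *)
Lemma mul_dual s H Y : s^T *m N = 0 -> dual N s H Y -> N *m Y = orth_proj s.
Proof.
move=> sN [Y1 Y0 Ys full]; apply/row_matrixP => u; apply/eqP.
rewrite -subr_eq0 -linearB /=; apply/eqP/full => [e eH|]; last first.
  by rewrite -row_mul mulmxBl -mulmxA Ys mulmx0 orth_proj_ker subrr row0.
(* For [e] in [H], column [e] of [Y *m N] is a unit vector, so [N *m Y] fixes column [e] of [N]; the
   projection fixes it too. *)
rewrite row_mulE mulmxBl mul_orth_proj // -mulmxA mxE [X in X + _]mxE [X in _ + X]mxE.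
rewrite (bigD1 e) //= Y1 // eqxx mulr1 big1 ?addr0 ?subrr // => i ie.
have [iH|iH] := boolP (i \in H); first by rewrite Y1 // (negPf ie) mulr0.
by rewrite [X in _ * X]mxE big1 ?mulr0 // => j _; rewrite Y0 // mul0r.
Qed.

Lemma dual_uniq s H Y Y' : dual N s H Y -> dual N s H Y' -> Y = Y'.
Proof.
move=> [Y1 Y0 Ys full] [Y1' Y0' Ys' _]; apply/row_matrixP => i.
have [iH|iH] := boolP (i \in H); last by apply/rowP => j; rewrite !mxE Y0 // Y0'.
apply/eqP; rewrite -subr_eq0 -linearB /=; apply/eqP/full => [e eH|].
  by rewrite row_mulE mulmxBl mxE [X in _ + X]mxE Y1 // Y1' // subrr.
by rewrite -row_mul mulmxBl Ys Ys' subrr row0.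
Qed.

(** A pivot step: row [i], divided by [c], becomes row [k], and a multiple of row [i] clears
    coordinate [k] of the other rows. *)
Lemma exchange_dual s F Y i k :
  i \notin F -> k \notin F -> i != k -> dual N s (i |: F) Y ->
  (Y *m N) i k != 0 ->
  exists2 Y', dual N s (k |: F) Y' & (Y' *m N) k i = ((Y *m N) i k)^-1.
Proof.
move=> iF kF ik [Y1 Y0 Ys full]; set c := (Y *m N) i k => c0.
have iH : i \in i |: F by rewrite setU11.
have sF e : e \in F -> e \in i |: F by move=> eF; rewrite inE eF orbT.
have FNi e : e \in F -> (i == e) = false.
  by move=> eF; apply/negbTE; apply: contraNneq iF => ->.
have FNk e : e \in F -> (k == e) = false.
  by move=> eF; apply/negbTE; apply: contraNneq kF => ->.
pose y a : 'rV[R]_n := if a == k then c^-1 *: row i Y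
  else if a \in F then row a Y - ((Y *m N) a k / c) *: row i Y else 0.
pose Y' := \matrix_a y a.
have yN a e : (Y' *m N) a e = if a == k then c^-1 * (Y *m N) i e
  else if a \in F then (Y *m N) a e - (Y *m N) a k / c * (Y *m N) i e else 0.
  rewrite -row_mulE rowK /y; case: ifP => _; first by rewrite -scalemxAl mxE row_mulE.
  case: ifP => _; last by rewrite mul0mx mxE.
  by rewrite mulmxBl -scalemxAl mxE [X in _ + X]mxE [X in _ - X]mxE !row_mulE.
exists Y'; last by rewrite yN eqxx Y1 // eqxx mulr1.
have Ys1 a : row a Y *m s = 0 by rewrite -row_mul Ys row0.
split.
- move=> a e; rewrite !in_setU1 yN => /orP[/eqP->|aF] /orP[/eqP->|eF].
  + by rewrite !eqxx mulVf.
  + by rewrite eqxx (Y1 _ _ iH (sF _ eF)) FNi // FNk // mulr0.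
  + by rewrite eq_sym FNk // aF divfK // subrr.
  + rewrite eq_sym FNk // aF (Y1 _ _ iH (sF _ eF)) (Y1 _ _ (sF _ aF) (sF _ eF)).
    by rewrite FNi // mulr0 subr0.
- move=> a j; rewrite in_setU1 negb_or => /andP[ak aF].
  by rewrite mxE /y (negPf ak) (negPf aF) mxE.
- apply/row_matrixP => a; rewrite row_mul rowK row0 /y.
  case: ifP => _; first by rewrite -scalemxAl Ys1 scaler0.
  case: ifP => _; last by rewrite mul0mx.
  by rewrite mulmxBl -scalemxAl !Ys1 scaler0 subrr.
(* Removing [mu] times row [i] gives a vector that kills [i |: F], so [r] is that multiple; its
   value at [k] is [mu * c], whence [mu = 0]. *)
move=> r kr rs; set mu := (r *m N) 0 i.
have r0 : 1 *: r + (- mu) *: row i Y = 0.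
  apply: full; last by rewrite mulmxDl -!scalemxAl rs Ys1 !scaler0 addr0.
  move=> e; rewrite in_setU1 mulmxDl -!scalemxAl mxE [X in X + _]mxE [X in _ + X]mxE row_mulE.
  case/orP => [/eqP->|eF]; first by rewrite Y1 // eqxx mul1r mulr1 subrr.
  by rewrite kr ?in_setU1 ?eF ?orbT // (Y1 _ _ iH (sF _ eF)) FNi // !mulr0 addr0.
have rE : r = mu *: row i Y.
  by move/eqP: r0; rewrite scale1r scaleNr subr_eq0 => /eqP.
have : (r *m N) 0 k = 0 by apply: kr; rewrite setU11.
rewrite rE -scalemxAl mxE row_mulE -/c => /eqP; rewrite mulf_eq0 (negPf c0) orbF.
by move/eqP->; rewrite scale0r.
Qed.

(** A boolean form of the last clause of [dual], so that a minimal set can be chosen; columns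
    outside [H] are masked by zero. *)
Definition full_cols s H : bool :=
  row_free (row_mx (\matrix_(u, e) (N u e *+ (e \in H))) s).

Lemma mul_mask H (r : 'rV[R]_n) e :
  (r *m \matrix_(u, e) (N u e *+ (e \in H))) 0 e = (r *m N) 0 e *+ (e \in H).
Proof. by rewrite !mxE -sumrMnl; apply: eq_bigr => u _; rewrite mxE mulrnAr. Qed.

Lemma mask_eq0 s H (r : 'rV[R]_n) :
  r *m row_mx (\matrix_(u, e) (N u e *+ (e \in H))) s = 0 <->
  kills N H r /\ r *m s = 0.
Proof.
rewrite mul_mx_row; split=> [/eqP|[kr ->]].
  rewrite row_mx_eq0 => /andP[/eqP r0 /eqP ->]; split=> // e eH.
  by have := mul_mask H r e; rewrite r0 eH mulr1n => <-; rewrite mxE.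
apply/eqP; rewrite row_mx_eq0 eqxx andbT; apply/eqP/rowP => e.
by rewrite mul_mask [RHS]mxE; case: (boolP (e \in H)) => // /kr ->.
Qed.

Lemma full_colsP s H : reflect
  (forall r : 'rV_n, kills N H r -> r *m s = 0 -> r = 0) (full_cols s H).
Proof.
apply: (iffP idP) => [fr r kr rs|h].
  apply/eqP; rewrite -(mulmx_free_eq0 _ fr); apply/eqP/mask_eq0; by split.
rewrite /full_cols -kermx_eq0; apply/eqP/row_matrixP => i; rewrite row0.
have /mask_eq0[kr rs] : row i (kermx (row_mx (\matrix_(u, e) (N u e *+ (e \in H))) s))
    *m row_mx (\matrix_(u, e) (N u e *+ (e \in H))) s = 0.
  by rewrite -row_mul mulmx_ker row0.
exact: h.
Qed.

Lemma not_full_cols s H : ~~ full_cols s H ->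
  exists r : 'rV_n, [/\ kills N H r, r *m s = 0 & r != 0].
Proof.
rewrite /full_cols -kermx_eq0 -nz_row_eq0; set K := kermx _ => K0.
exists (nz_row K).
have /mask_eq0[] : nz_row K *m row_mx (\matrix_(u, e) (N u e *+ (e \in H))) s = 0.
  by apply/sub_kermxP; apply: nz_row_sub.
by [].
Qed.

Lemma dual_rows s H :
  (forall i, i \in H -> exists y : 'rV_n,
    [/\ kills N (H :\ i) y, (y *m N) 0 i != 0 & y *m s = 0]) ->
  exists Y : 'M[R]_(m, n),
    [/\ forall i e, i \in H -> e \in H -> (Y *m N) i e = (i == e)%:R,
        forall i j, i \notin H -> Y i j = 0 & Y *m s = 0].
Proof.
move=> hy; have /fin_all_exists[f fP] : forall i, exists y : 'rV[R]_n,
    [/\ i \in H -> forall e, e \in H -> (y *m N) 0 e = (i == e)%:R,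
        i \notin H -> y = 0 & y *m s = 0].
  move=> i; have [iH|iH] := boolP (i \in H); last first.
    by exists 0; split; rewrite ?mul0mx // (negPf iH).
  have [y [ky y0 ys]] := hy i iH; exists (((y *m N) 0 i)^-1 *: y); split => //.
    move=> _ e eH; rewrite -scalemxAl mxE; have [<-|ie] := eqVneq i e.
      by rewrite mulVf.
    by rewrite (ky e) ?mulr0 // in_setD1 eq_sym ie.
  by rewrite -scalemxAl ys scaler0.
exists (\matrix_i f i); split.
- by move=> i e iH eH; rewrite -row_mulE rowK; case: (fP i) => /(_ iH) ->.
- by move=> i j iH; rewrite mxE; case: (fP i) => _ /(_ iH) -> _; rewrite mxE.
- by apply/row_matrixP => i; rewrite row_mul rowK row0; case: (fP i).
Qed.

Lemma dual_of_rows s H :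
  (forall i, i \in H -> exists y : 'rV_n,
    [/\ kills N (H :\ i) y, (y *m N) 0 i != 0 & y *m s = 0]) ->
  (forall r : 'rV_n, kills N H r -> r *m s = 0 -> r = 0) ->
  exists Y, dual N s H Y.
Proof. by move=> /dual_rows[Y [Y1 Y0 Ys]] full; exists Y. Qed.

(** Take a minimal set [H] with trivial joint kernel. Dropping [i] creates a nonzero kernel vector,
    which cannot kill [i] and so yields the dual row of [i]. *)
Lemma dual_exists s :
  (forall r : 'rV_n, kills N setT r -> r *m s = 0 -> r = 0) ->
  exists H Y, dual N s H Y.
Proof.
move=> /full_colsP /minset_exists[H /minsetP[fH minH] _]; exists H.
apply: dual_of_rows; last exact/full_colsP.
move=> i iH; have : ~~ full_cols s (H :\ i).
  apply/negP => /minH /(_ (subD1set _ _)) /setP /(_ i).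
  by rewrite !inE eqxx iH.
case/not_full_cols => y [ky ys y0]; exists y; split => //.
apply: contraNneq y0 => yi; apply/eqP; move/full_colsP: fH; apply=> // e eH.
by have [->|ei] := eqVneq e i => //; apply: ky; rewrite !inE ei.
Qed.

(** * Inverses of the submatrices of columns *)

Definition subrows Y H : 'M[R]_(#|H|, n) := rowsub enum_val Y.

Lemma mul_subrows_subcols Y H a b :
  (subrows Y H *m subcols N H) a b = (Y *m N) (enum_val a) (enum_val b).
Proof. by rewrite !mxE; apply: eq_bigr => k _; rewrite !mxE. Qed.

Lemma mul_subcols_subrows Y H : (forall i j, i \notin H -> Y i j = 0) ->
  subcols N H *m subrows Y H = N *m Y.
Proof.
move=> Y0; apply/matrixP => u j; rewrite !mxE.
transitivity (\sum_(i in H) N u i * Y i j).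
  by rewrite [RHS]big_enum_val; apply: eq_bigr => k _; rewrite !mxE.
rewrite [RHS](bigID (mem H)) /= [X in _ + X]big1 ?addr0 // => i iH.
by rewrite Y0 ?mulr0.
Qed.

Lemma entry_at_subrows Y H i j : (forall i j, i \notin H -> Y i j = 0) ->
  entry_at (subrows Y H) i j = Y i j.
Proof.
move=> Y0; rewrite /entry_at; case: pickP => [k /eqP <-|none]; first by rewrite mxE.
rewrite Y0 //; apply/negP => iH; have := none (enum_rank_in iH i).
by rewrite enum_rankK_in // eqxx.
Qed.

Lemma subrows_left_inverse s H Y : dual N s H Y -> subrows Y H *m subcols N H = 1%:M.
Proof.
move=> [Y1 _ _ _]; apply/matrixP => a b; rewrite mul_subrows_subcols.
by rewrite Y1 ?enum_valP // mxE (inj_eq enum_val_inj).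
Qed.

(** A left inverse whose product in the other order is symmetric satisfies the four Penrose
    equations. *)
Lemma subrows_mpinv s H Y : s^T *m N = 0 -> dual N s H Y ->
  mpinv (subcols N H) = subrows Y H.
Proof.
move=> sN dY; apply/esym/mpinv_uniq.
have YN := subrows_left_inverse dY; have NY := mul_dual sN dY.
have NY' : subcols N H *m subrows Y H = orth_proj s.
  by rewrite mul_subcols_subrows //; case: dY.
apply/and4P; split; apply/eqP.
- by rewrite -mulmxA YN mulmx1.
- by rewrite YN mul1mx.
- by rewrite NY' orth_proj_tr.
- by rewrite YN trmx1.
Qed.

Lemma entry_at_mpinv s H Y i j : s^T *m N = 0 -> dual N s H Y ->
  entry_at (mpinv (subcols N H)) i j = Y i j.
Proof. by move=> sN dY; rewrite (subrows_mpinv sN dY) entry_at_subrows //; case: dY. Qed.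

(** For [s = 0] the projection is the identity, so both products are identities and the ranks bound
    each size by the other. *)
Lemma dual0_card H Y : dual N 0 H Y -> #|H| = n.
Proof.
move=> dY; have YN := subrows_left_inverse dY.
have NY : subcols N H *m subrows Y H = 1%:M.
  by rewrite mul_subcols_subrows ?(mul_dual _ dY) ?orth_proj0 ?trmx0 ?mul0mx //; case: dY.
by apply/eqP; rewrite eqn_leq (mulmx1_min YN) (mulmx1_min NY).
Qed.

Lemma dual0_sqinv H Y : dual N 0 H Y ->
  [/\ sqinv (subcols N H) = subrows Y H,
      subcols N H *m sqinv (subcols N H) = 1%:M
    & sqinv (subcols N H) *m subcols N H = 1%:M].
Proof.
move=> dY; have YN := subrows_left_inverse dY; have cH := dual0_card dY.
have NY : subcols N H *m subrows Y H = 1%:M by rewrite (mulmx1_swap cH YN).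
by rewrite (sqinv_uniq (esym cH) NY); split.
Qed.

(** Counting replaces the kernel condition: a left inverse of a square matrix is also a right
    inverse. *)
Lemma dual0_of_card H :
  (forall i, i \in H -> exists2 y : 'rV_n, kills N (H :\ i) y & (y *m N) 0 i != 0) ->
  #|H| = n -> exists Y, dual N 0 H Y.
Proof.
move=> hy cH; have [|Y [Y1 Y0 _]] := @dual_rows 0 H.
  by move=> i /hy[y ky y0]; exists y; rewrite mulmx0.
exists Y; split=> //; first by rewrite mulmx0.
move=> r kr _; have YN : subrows Y H *m subcols N H = 1%:M.
  apply/matrixP => a b; rewrite mul_subrows_subcols.
  by rewrite Y1 ?enum_valP // mxE (inj_eq enum_val_inj).
rewrite -[r]mulmx1 -(mulmx1_swap cH YN) mulmxA (_ : r *m _ = 0) ?mul0mx //.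
apply/rowP => a; rewrite [RHS]mxE -(kr (enum_val a) (enum_valP a)) !mxE.
by apply: eq_bigr => u _; rewrite !mxE.
Qed.

(* The weights make the weighted sum of the [Y *m N] symmetric: the sets
   [i |: F] and [k |: F] contribute [w * c] to the entries [(i, k)] and
   [(k, i)], so that the average satisfies the Penrose equations. *)
Lemma mpinv_average s (B : {set {set 'I_m}}) (w : {set 'I_m} -> R) :
  s^T *m N = 0 ->
  (forall H, H \in B <-> exists Y, dual N s H Y) ->
  (exists H, H \in B) ->
  (forall H, 0 < w H) ->
  (forall F i k Y, i \notin F -> k \notin F -> i != k -> dual N s (i |: F) Y ->
    (Y *m N) i k != 0 -> w (k |: F) = w (i |: F) * ((Y *m N) i k * (Y *m N) i k)) ->
  forall i j, mpinv N i j = (\sum_(H in B) w H)^-1 *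
    \sum_(H in B | i \in H) w H * entry_at (mpinv (subcols N H)) i j.
Proof.
move=> sN BP [H0 H0B] w0 wx i0 j0.
set W := \sum_(H in B) w H.
have W0 : W != 0.
  rewrite /W (bigD1 H0) //= gt_eqF // ltr_wpDr // sumr_ge0 // => H _.
  exact: ltW.
pose Y H : 'M[R]_(m, n) := \matrix_(i, j) entry_at (mpinv (subcols N H)) i j.
have dY H : H \in B -> dual N s H (Y H).
  case/BP => Z dZ; suff -> : Y H = Z by [].
  by apply/matrixP => i j; rewrite mxE (entry_at_mpinv _ _ sN dZ).
pose M := W^-1 *: \sum_(H in B) w H *: Y H.
suff <- : M = mpinv N.
  rewrite !mxE summxE; congr (_ * _); rewrite [RHS]big_mkcondr.
  apply: eq_bigr => H HB; rewrite !mxE; case: ifP => // /negbT iH.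
  by have [_ Y0 _ _] := dY H HB; have := Y0 _ j0 iH; rewrite mxE => ->; rewrite mulr0.
have NM : N *m M = orth_proj s.
  rewrite -scalemxAr mulmx_sumr.
  under eq_bigr => H HB do rewrite -scalemxAr (mul_dual sN (dY H HB)).
  by rewrite -scaler_suml scalerA mulVf // scale1r.
have Ms : M *m s = 0.
  rewrite -scalemxAl mulmx_suml big1 ?scaler0 // => H /dY[_ _ Ys _].
  by rewrite -scalemxAl Ys scaler0.
pose g i k H := w H * (Y H *m N) i k.
have MNE i k : (M *m N) i k = W^-1 * \sum_(H in B) g i k H.
  rewrite -scalemxAl mxE mulmx_suml summxE; congr (_ * _).
  by apply: eq_bigr => H _; rewrite -scalemxAl mxE.
(* Off-diagonal terms are indexed by [F], the set [H] without [i], so that [i |: F] and [k |: F]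
   share an index. *)
pose t i k F := if [&& i |: F \in B, i \notin F & k \notin F] then g i k (i |: F) else 0.
have gE i k : i != k -> \sum_(H in B) g i k H = \sum_F t i k F.
  move=> ik; rewrite (bigID (fun H : {set 'I_m} => (i \in H) && (k \notin H))) /=.
  rewrite [X in _ + X]big1 ?addr0; last first.
    (* If [H] contains both [i] and [k], duality makes the entry zero; if [H] misses [i], row [i] is
       zero. *)
    move=> H /andP[/dY[Y1 Y0 _ _]]; rewrite negb_and negbK /g => h.
    have [iH|iH] := boolP (i \in H).
      by rewrite iH /= in h; rewrite Y1 // (negPf ik) mulr0.
    by rewrite [X in _ * X]mxE big1 ?mulr0 // => j _; rewrite Y0 // mul0r.
  rewrite /t -big_mkcond /=.
  rewrite (reindex_onto (fun F => i |: F) (fun H => H :\ i)) /=; last first.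
    by move=> H /and3P[_ iH _]; rewrite setD1K.
  apply: eq_bigl => F; rewrite !inE eqxx /= negb_or [k == i]eq_sym ik /=.
  have [iF|iF] := boolP (i \in F); last by rewrite setU1K // eqxx andbT.
  rewrite /= andbF; apply/negbTE; rewrite negb_and; apply/orP; right.
  by apply/negP => /eqP/setP/(_ i); rewrite !inE eqxx iF.
have tE i k F : i != k -> t i k F != 0 -> t k i F = t i k F.
  move=> ik; rewrite {1 3}/t; case: ifP => [/and3P[iB iF kF]|]; last by rewrite eqxx.
  rewrite /g mulf_eq0 negb_or => /andP[_ c0].
  have [Y' dY' Y'E] := exchange_dual iF kF ik (dY _ iB) c0.
  have kB : k |: F \in B by apply/BP; exists Y'.
  rewrite /t kB iF kF /= /g -(dual_uniq dY' (dY _ kB)) Y'E.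
  by rewrite (wx F i k _ iF kF ik (dY _ iB) c0) mulrA mulfK.
have symMN : (M *m N)^T = M *m N.
  apply/matrixP => i k; rewrite mxE !MNE; have [->//|ik] := eqVneq i k.
  (* [tE] applies once one of the two terms is nonzero; if both vanish there is nothing to prove. *)
  rewrite !gE // 1?eq_sym //; congr (_ * _); apply: eq_bigr => F _.
  have [t0|t0] := eqVneq (t i k F) 0; last by rewrite tE.
  have [t1|t1] := eqVneq (t k i F) 0; first by rewrite t0.
  by rewrite -[LHS]tE // eq_sym.
apply: mpinv_uniq; apply/and4P; split; apply/eqP => //.
- by rewrite NM mul_orth_proj.
- by rewrite -mulmxA NM orth_proj_mul.
- by rewrite NM orth_proj_tr.
Qed.

End DualBases.

(** * Unbalanced graphs *)

Section Unbalanced.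
Variables (R : realFieldType) (n m : nat) (G : sgraph n m) (N : 'M[R]_(n, m)).
Hypothesis NI : incidence G N.
Implicit Types (F H C T : {set 'I_m}) (X : {set 'I_n}) (e : 'I_m) (u v x : 'I_n).
Implicit Types (r y z : 'rV[R]_n).

Local Notation sg e := ((sigma G e)%:~R : R).

(** On a balanced cycle, a vector killing all edges but [e] kills [e] too, against the value 1 of
    the dual row. *)
Lemma dual_cycle_unbalanced s H Y C : dual N s H Y -> C \in cycles_of G H ->
  ~~ balanced_cycle G C.
Proof.
move=> dY; rewrite inE => /andP[cC sCH]; apply/negP => bC.
have [e eC] := cycle_nonempty cC; have eH := subsetP sCH _ eC.
have := kills_balanced_cycle NI cC bC eC (killsS (setSD _ sCH) (dual_kills dY eH)).
by rewrite (dual_diag dY eH) => /eqP; rewrite oner_eq0.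
Qed.

Lemma connected_component F X : X \in components G F -> connected_sub G X (edges_in G F X).
Proof.
case/componentsP => w ->; apply/forall_inP => u wu; apply/forall_inP => v wv.
apply: connect_edges_in => //; first exact: component_closed.
by rewrite -(component_eq wu) inE in wv.
Qed.

(** Let [C] and [C'] be cycles of one component, with [e] in [C] only. The dual row of [e] vanishes
    on the unbalanced cycle [C'], hence on the whole component, which stays connected without [e];
    this contradicts its value 1 at [e]. So a component has at most one cycle. *)
Lemma dual0_TU H Y : dual N 0 H Y -> H \in TU G.
Proof.
move=> dY; rewrite inE (dual0_card dY) eqxx /=; apply/forall_inP => X XH.
have conn := connected_component XH; set U := edges_in G H X in conn *.
have sUH : U \subset H by apply: edges_in_sub.
have cycU C : C \in cycles_of G U -> C \in cycles_of G H.
  by rewrite !inE => /andP[-> sC]; rewrite (subset_trans sC).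
have subC C C' : C \in cycles_of G U -> C' \in cycles_of G U -> C \subset C'.
  move=> CU CU'; apply/subsetP => e eC; apply/negPn/negP => eC'.
  have /andP[cC sC] : is_cycle G C && (C \subset U) by rewrite inE in CU.
  have /andP[cC' sC'] : is_cycle G C' && (C' \subset U) by rewrite inE in CU'.
  have eU := subsetP sC _ eC; have eH := subsetP sUH _ eU.
  have ky := dual_kills dY eH.
  have [a [b [p [E /is_path_connect cab _]]]] := cycle_split cC eC.
  have {}cab : connect (adj G (U :\ e)) a b by apply: connect_mono cab; apply: setSD.
  have [f fC'] := cycle_nonempty cC'; have [x xf] := edge_ne G f.
  have xX : x \in X.
    by have := subsetP sC' _ fC'; rewrite inE => /andP[_ /subsetP]; apply.
  have y0 : (row e Y) 0 x = 0.
    apply: (kills_unbalanced_cycle NI cC' _ _ ky fC' xf).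
      by apply: dual_cycle_unbalanced dY _; apply: cycU.
    by apply: subset_trans (setSD _ sUH); rewrite subsetD1 sC'.
  have kU : kills N (U :\ e) (row e Y) by apply: killsS ky; apply: setSD.
  have yX a' : a' \in X -> (row e Y) 0 a' = 0.
    move=> aX; apply: (kills_connect0 NI kU) y0.
    apply: (connect_delete_cycle E cab).
    by move/forall_inP: conn => /(_ x xX)/forall_inP/(_ _ aX).
  have := dual_diag dY eH; rewrite (mul_edge NI _ E).
  have : edge G e \subset X by move: eU; rewrite inE => /andP[].
  rewrite E subUset !sub1set => /andP[/yX -> /yX ->].
  by rewrite !mul0r addr0 => /eqP; rewrite eq_sym oner_eq0.
apply/orP; rewrite /is_tree /unbalanced_unicyclic conn /=.
have [->|[C CU]] := set_0Vmem (cycles_of G U); first by left; rewrite eqxx.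
right; apply/existsP; exists C; rewrite (dual_cycle_unbalanced dY (cycU _ CU)) andbT.
apply/eqP/setP => C'; rewrite in_set1; apply/idP/eqP => [CU'|-> //].
by apply/eqP; rewrite eqEsubset !subC.
Qed.

Lemma TU_cycles H X : H \in TU G -> X \in components G H ->
  cycles_of G (edges_in G H X) = set0 \/
  exists2 C, cycles_of G (edges_in G H X) = [set C] & ~~ balanced_cycle G C.
Proof.
rewrite inE => /andP[_ /forall_inP HX] /HX /orP[/andP[_ /eqP]|/andP[_]].
  by left.
by case/existsP => C /andP[/eqP CU bC]; right; exists C.
Qed.

Lemma TU_independent H i : H \in TU G -> i \in H ->
  exists2 y, kills N (H :\ i) y & (y *m N) 0 i != 0.
Proof.
move=> HT iH; have [a [b [E ab]]] := edgeP G i.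
set X := component G H a; set U := edges_in G H X.
have aX : a \in X := mem_component G H a.
have clX : closed_in G H X := @component_closed _ _ G H a.
have clXi : closed_in G (H :\ i) X.
  by move=> e u v; rewrite in_setD1 => /andP[_]; apply: clX.
have iU : i \in U by apply: edges_in_closed iH E aX.
have bX : b \in X by apply: clX iH E aX.
have cycU : forall C, C \in cycles_of G U ->
    ~~ balanced_cycle G C /\ forall C', C' \in cycles_of G U -> C' = C.
  have [U0|[C U1 bC]] := TU_cycles HT (components_mem G H a).
    by move=> C; rewrite /U U0 inE.
  by move=> C'; rewrite /U U1 inE => /eqP->; split=> // C''; rewrite inE => /eqP.
(* If [i] lies on the cycle, [U :\ i] is acyclic and carries a switching function. It cannot kill
   [i] as well, since it would then vanish on the unbalanced cycle. *)
have [/existsP[C /andP[CU iC]]|noC] := boolP [exists C, (C \in cycles_of G U) && (i \in C)].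
  have [bC uC] := cycU C CU.
  have [C'|z z1 kz] := potential_exists NI (F := U :\ i).
    rewrite inE subsetD1 => /and3P[cC' sC' iC'].
    by rewrite (uC C') ?inE ?cC' // iC in iC'.
  have ky : kills N (H :\ i) (restrict X z).
    by apply: (kills_restrict NI clXi); rewrite edges_inD1.
  exists (restrict X z) => //; apply/eqP => y0.
  have kH : kills N H (restrict X z).
    move=> e eH; have [->//|ei] := eqVneq e i.
    by apply: ky; rewrite in_setD1 ei.
  have /andP[cC sC] : is_cycle G C && (C \subset U) by rewrite inE in CU.
  have sCH : C \subset H := subset_trans sC (edges_in_sub G H X).
  have : (restrict X z) 0 a = 0.
    by apply: (kills_unbalanced_cycle NI cC bC sCH kH iC); rewrite E !inE eqxx.
  rewrite mxE aX => za; have := z1 a; rewrite za mul0r => /eqP.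
  by rewrite eq_sym oner_eq0.
(* Otherwise [i] is a bridge, and a switching function supported on an acyclic side does not kill
   [i]. *)
have cab : ~~ connect (adj G (H :\ i)) a b.
  apply/negP => /(connect_edges_in clXi aX); rewrite edges_inD1 -/U.
  case/connect_is_path => p pP; case/existsP: noC.
  have iUi : i \notin U :\ i by rewrite !inE eqxx.
  exists (i |: path_edges G a p); rewrite setU11 andbT inE (cycle_of_path E iUi pP).
  rewrite subUset sub1set iU /=.
  case/and3P: pP => /path_edges_sub sp _ _; exact: subset_trans sp (subD1set _ _).
pose K w := component G (H :\ i) w.
have acyc w w' : edge G i = [set w; w'] -> ~~ connect (adj G (H :\ i)) w w' ->
    cycles_of G (edges_in G (H :\ i) (K w)) = set0 ->
    exists2 y, kills N (H :\ i) y & (y *m N) 0 i != 0.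
  move=> Ew cw c0; have [C|z z1 kz] := potential_exists NI (F := edges_in G (H :\ i) (K w)).
    by rewrite c0 inE.
  exists (restrict (K w) z).
    by apply: (kills_restrict NI) kz; apply: component_closed.
  apply/eqP => /(kills_edge NI _ Ew); rewrite !mxE mem_component inE (negPf cw) mulr0 => zw.
  by have := z1 w; rewrite zw mul0r => /eqP; rewrite eq_sym oner_eq0.
have [|[C Ca]] := set_0Vmem (cycles_of G (edges_in G (H :\ i) (K a))).
  exact: acyc E cab.
have [|[C' Cb]] := set_0Vmem (cycles_of G (edges_in G (H :\ i) (K b))).
  by apply: (acyc b a); rewrite 1?adj_connect_sym // setUC.
have sK w : w \in X -> edges_in G (H :\ i) (K w) \subset U.
  move=> wX; apply/subsetP => e; rewrite !inE => /andP[/andP[_ ->] sw] /=.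
  apply: subset_trans sw _; apply/subsetP => x; rewrite inE => wx.
  exact: closed_in_connect clXi wX wx.
have inU w C0 : w \in X -> C0 \in cycles_of G (edges_in G (H :\ i) (K w)) ->
    C0 \in cycles_of G U.
  by move=> wX; rewrite !inE => /andP[-> sC0]; apply: subset_trans (sK w wX).
have [_ uC] := cycU C (inU a C aX Ca).
move: (Cb); rewrite (uC C' (inU b C' bX Cb)) inE => /andP[cC sCb].
move: Ca; rewrite inE => /andP[_ sCa].
(* If neither side is acyclic, uniqueness puts the same cycle on both sides, which connects them
   without [i]. *)
have [e eC] := cycle_nonempty cC; have [x xe] := edge_ne G e.
have conx w : C \subset edges_in G (H :\ i) (K w) -> connect (adj G (H :\ i)) w x.
  move/subsetP/(_ _ eC); rewrite inE => /andP[_ /subsetP/(_ _ xe)].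
  by rewrite inE.
case/negP: cab; apply: connect_trans (conx a sCa) _.
by rewrite adj_connect_sym; apply: conx.
Qed.

Lemma TU_dual H : H \in TU G <-> exists Y, dual N 0 H Y.
Proof.
split=> [HT|[Y]]; last exact: dual0_TU.
apply: dual0_of_card => [i iH|]; first exact: TU_independent.
by move: HT; rewrite inE => /andP[/eqP].
Qed.

(** A switching function on a tree component would be a nonzero vector killing [H], so no component
    is a tree. *)
Lemma TU_unicyclic H X : H \in TU G -> X \in components G H ->
  exists2 C, cycles_of G (edges_in G H X) = [set C] & ~~ balanced_cycle G C.
Proof.
move=> HT XH; have [U0|//] := TU_cycles HT XH.
case/TU_dual: HT => Y [_ _ _ full].
have [C|z z1 kz] := potential_exists NI (F := edges_in G H X).
  by rewrite U0 inE.
have [w XE] := componentsP _ _ _ XH.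
have : restrict X z = 0.
  apply: full; last by rewrite mulmx0.
  by apply: (kills_restrict NI) kz; rewrite XE; apply: component_closed.
move/rowP/(_ w); rewrite !mxE XE mem_component => zw.
by have := z1 w; rewrite zw mul0r => /eqP; rewrite eq_sym oner_eq0.
Qed.

Lemma num_unicyclicE H : H \in TU G -> num_unicyclic G H = #|components G H|.
Proof.
move=> HT; congr #|pred_of_set _|; apply/setP => X; rewrite inE.
have [XH|//] := boolP (X \in components G H).
have [C CU bC] := TU_unicyclic HT XH.
rewrite /unbalanced_unicyclic connected_component //=.
by apply/existsP; exists C; rewrite CU eqxx.
Qed.

(* The row [y] spans the left kernel of [F]: it is supported on a single
   component of [F], where it takes the values [q] and [- q]. *)
Lemma left_kernel_weight F i Y : dual N 0 (i |: F) Y -> i \notin F ->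
  exists2 q : R, q != 0 & forall k, (Y *m N) i k != 0 ->
    (Y *m N) i k * (Y *m N) i k * 4 ^+ #|components G F| =
    4 * (q * q) * 4 ^+ #|components G (k |: F)|.
Proof.
move=> dY iF; have iH : i \in i |: F by rewrite setU11.
set y := row i Y; have y1 : (y *m N) 0 i = 1 := dual_diag dY iH.
have ky : kills N F y by have := dual_kills dY iH; rewrite setU1K.
have [a ya] : exists a, y 0 a != 0.
  apply/existsP; apply: contraT; rewrite negb_exists => /forallP y0.
  suff : y = 0 by move=> yE; move: y1; rewrite yE mul0mx mxE => /eqP; rewrite eq_sym oner_eq0.
  by apply/rowP => x; rewrite [RHS]mxE; apply/eqP; have := y0 x; rewrite negbK.
(* The restriction to [K] still kills [F], so it is a multiple of [y]; comparison at [a] gives the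
   factor 1, and [y] is supported on [K]. *)
pose K := component G F a; pose mu := (restrict K y *m N) 0 i.
have rE : restrict K y = mu *: y.
  have [_ _ _ full] := dY.
  apply/eqP; rewrite -subr_eq0; apply/eqP/full; last by rewrite mulmx0.
  move=> e; rewrite in_setU1 mulmxBl -scalemxAl mxE [X in _ + X]mxE [X in _ - X]mxE.
  case/orP=> [/eqP->|eF]; first by rewrite y1 mulr1 subrr.
  by rewrite ky // kills_component // mulr0 subr0.
have mu1 : mu = 1.
  move/rowP/(_ a): (rE); rewrite [LHS]mxE [RHS]mxE mem_component => h.
  by apply: (mulIf ya); rewrite mul1r -h.
have y0 x : ~~ connect (adj G F) a x -> y 0 x = 0.
  by move=> ax; move/rowP/(_ x): (rE); rewrite mu1 scale1r mxE inE (negPf ax).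
have ysq x : connect (adj G F) a x -> y 0 x * y 0 x = y 0 a * y 0 a.
  exact: (kills_connect_sq NI ky).
have sq2 p : p * p = y 0 a * y 0 a -> p = y 0 a \/ p = - y 0 a.
  by move=> /eqP; rewrite -!expr2 eqf_sqr => /orP[]/eqP; [left|right].
exists (y 0 a) => // k; rewrite -row_mulE -/y => c0.
have [u [v [E _]]] := edgeP G k.
have cE := mul_edge_sg NI y E; have Nu := incidence_sq NI E; have ss := sg_sq R G k.
have csq : (y *m N) 0 k * (y *m N) 0 k
    = (y 0 u - sg k * y 0 v) * (y 0 u - sg k * y 0 v).
  by rewrite cE mulrACA Nu mul1r.
(* With both ends of [k] in one component of [F], nonvanishing forces two values of size [q] to add
   up, and the square is [4 * (q * q)]. *)
rewrite csq; have [uv|uv] := boolP (connect (adj G F) u v).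
  rewrite (components_add_inner E uv); congr (_ * _).
  have [au|au] := boolP (connect (adj G F) a u); last first.
    have av : ~~ connect (adj G F) a v.
      by apply: contra au => av; apply: connect_trans av _; rewrite adj_connect_sym.
    by move: c0; rewrite cE (y0 _ au) (y0 _ av) mulr0 subrr mulr0 eqxx.
  have av := connect_trans au uv.
  have wsq : sg k * y 0 v * (sg k * y 0 v) = y 0 a * y 0 a.
    by rewrite mulrACA ss mul1r ysq.
  have {c0} : y 0 u - sg k * y 0 v != 0 by apply: contraNneq c0; rewrite cE => ->; rewrite mulr0.
  have [->|->] := sq2 _ (ysq _ au); have [->|->] := sq2 _ wsq.
  - by rewrite subrr eqxx.
  - by move=> _; ring.
  - by move=> _; ring.
  - by rewrite opprK addNr eqxx.
(* Here only one end of [k] lies in [K]: the square is [q * q], and the lost component supplies the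
   factor 4. *)
rewrite (components_add_bridge E uv) exprS mulrA; congr (_ * _).
have [au|au] := boolP (connect (adj G F) a u).
  have av : ~~ connect (adj G F) a v.
    by apply: contra uv => av; apply: connect_trans av; rewrite adj_connect_sym.
  by rewrite (y0 _ av) mulr0 subr0 ysq // mulrC.
have [av|av] := boolP (connect (adj G F) a v).
  by rewrite (y0 _ au) sub0r mulrNN mulrACA ss mul1r ysq // mulrC.
by move: c0; rewrite cE (y0 _ au) (y0 _ av) mulr0 subrr mulr0 eqxx.
Qed.

(** [left_kernel_weight] is applied to [k] and to [i] itself, whose coordinate is 1; the common
    factor [4 * (q * q)] cancels. *)
Lemma TU_weight_exchange F i k Y : i \notin F -> k \notin F -> i != k ->
  dual N 0 (i |: F) Y -> (Y *m N) i k != 0 ->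
  4 ^+ num_unicyclic G (k |: F) =
    4 ^+ num_unicyclic G (i |: F) * ((Y *m N) i k * (Y *m N) i k) :> R.
Proof.
move=> iF kF ik dY c0; have [Y' dY' _] := exchange_dual iF kF ik dY c0.
rewrite (num_unicyclicE (dual0_TU dY)) (num_unicyclicE (dual0_TU dY')).
have [q q0 qP] := left_kernel_weight dY iF.
have h4 : 4 * (q * q) != 0 :> R by rewrite !mulf_neq0 ?pnatr_eq0.
have ii : (Y *m N) i i = 1 by rewrite -row_mulE (dual_diag dY) ?setU11.
have := qP i; rewrite ii !mul1r oner_eq0 => /(_ isT) Ei.
have := qP k c0; rewrite Ei => Ek; apply: (mulfI h4).
by rewrite -Ek [LHS]mulrC -[LHS]mulrA.
Qed.

Lemma unbalanced_full : connected_graph G -> ~~ balanced G ->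
  forall r, kills N setT r -> r = 0.
Proof.
move=> /forallP conn; rewrite negb_forall => /existsP[C].
rewrite negb_imply => /andP[cC bC] r kr; apply/rowP => v; rewrite [RHS]mxE.
have [e eC] := cycle_nonempty cC; have [x xe] := edge_ne G e.
apply: (kills_connect0 NI kr (u := x)); first exact/forallP.
exact: (kills_unbalanced_cycle NI cC bC (subsetT C) kr eC xe).
Qed.

Lemma mpinv_unbalanced : connected_graph G -> ~~ balanced G -> forall i j,
  mpinv N i j = (\sum_(H in TU G) 4%:R ^+ num_unicyclic G H)^-1 *
    \sum_(H in TU G | i \in H)
      4%:R ^+ num_unicyclic G H * entry_at (sqinv (subcols N H)) i j.
Proof.
move=> conn ub i j.
have N0 : (0 : 'cV[R]_n)^T *m N = 0 by rewrite trmx0 mul0mx.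
rewrite (@mpinv_average _ _ _ N 0 (TU G) (fun H => 4 ^+ num_unicyclic G H)) //.
- congr (_ * _); apply: eq_bigr => H /andP[/TU_dual[Y dY] _].
  have [-> _ _] := dual0_sqinv dY.
  by rewrite (entry_at_mpinv _ _ N0 dY) entry_at_subrows //; case: dY.
- exact: TU_dual.
- have [|H [Y dY]] := @dual_exists _ _ _ N 0.
    by move=> r kr _; apply: unbalanced_full.
  by exists H; apply/TU_dual; exists Y.
- by move=> H; rewrite exprn_gt0.
- exact: TU_weight_exchange.
Qed.

End Unbalanced.

(** * Balanced graphs and explicit entries *)

Section HeadTail.
Variables (R : realFieldType) (n m : nat) (G : sgraph n m) (N : 'M[R]_(n, m)).
Hypothesis NI : incidence G N.
Implicit Types (F H C T : {set 'I_m}) (X : {set 'I_n}) (e i : 'I_m) (u v x j : 'I_n).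
Implicit Types (r y z : 'rV[R]_n).

Local Notation sg e := ((sigma G e)%:~R : R).

Lemma edge_lo_hi e : edge G e = [set lo G e; hi G e].
Proof.
rewrite /lo /hi; case: arg_minnP => [|l le lmin]; first exact: xchooseP.
case: arg_maxnP => [|h he hmax]; first exact: xchooseP.
have [u [v [E uv]]] := edgeP G e.
apply/eqP; rewrite eq_sym eqEcard subUset !sub1set le he /= edge_card cards2.
suff -> : l != h by [].
apply: contraNneq uv => lh; apply/eqP/val_inj/eqP.
have ue : u \in edge G e by rewrite E !inE eqxx.
have ve : v \in edge G e by rewrite E !inE eqxx orbT.
have := lmin u ue; have := hmax u ue; have := lmin v ve; have := hmax v ve.
rewrite lh => v1 v2 u1 u2.
by rewrite eqn_leq (leq_trans u1 v2) (leq_trans v1 u2).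
Qed.

Lemma edge_tail_head e : edge G e = [set edge_tail G N e; edge_head G N e].
Proof.
rewrite edge_lo_hi /edge_tail /edge_head.
by case: ifP => _ //; case: ifP => _ //; rewrite setUC.
Qed.

(** A positive edge has entry 1 at its tail and weight 1; the two equal entries of a negative edge
    are its weight. *)
Lemma incidence_tail e : N (edge_tail G N e) e = weight G N e.
Proof.
have E := edge_lo_hi e; have [_ Nl Nh Nn Np] := NI E.
rewrite /edge_tail /weight; case: (sigmaP G e) => s; rewrite s /=.
  case: eqP => [->//|nl]; case: Nl => // lE.
  by have := Np s; rewrite lE => /eqP; rewrite eqr_opp => /eqP.
have lh := Nn s; case: ifP => [/forall_inP/(_ (lo G e))|/negP nall].
  by rewrite E !inE eqxx => /(_ isT)/eqP.
case: Nl => // lE; case: nall; apply/forall_inP => v.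
by rewrite E !inE => /orP[]/eqP->; rewrite -?lh lE.
Qed.

Lemma weight_sq e : weight G N e * weight G N e = 1.
Proof. by rewrite -incidence_tail (incidence_sq NI (edge_tail_head e)). Qed.

Lemma mul_tail_head r e : (r *m N) 0 e =
  weight G N e * (r 0 (edge_tail G N e) - sg e * r 0 (edge_head G N e)).
Proof. by rewrite (mul_edge_sg NI _ (edge_tail_head e)) incidence_tail. Qed.

Lemma kills_path_to_edge F i j p y : kills N (F :\ i) y -> path_to_edge G F i j p ->
  y 0 j = (sgn G j p)%:~R * y 0 (last j p).
Proof.
move=> ky /andP[/(kills_path NI ky) -> _].
by rewrite mulrA sgn_sq mul1r.
Qed.

Lemma path_to_edge_connect F i j p : path_to_edge G F i j p ->
  connect (adj G (F :\ i)) j (last j p).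
Proof. by case/andP => /is_path_connect. Qed.

Lemma path_to_edge_last F i j p : path_to_edge G F i j p ->
  last j p = edge_tail G N i \/ last j p = edge_head G N i.
Proof.
by case/andP => _; rewrite edge_tail_head !inE => /orP[]/eqP; [left|right].
Qed.

(** Both vectors acquire the same sign along a path, so their product is constant on components. *)
Lemma kills_ratio F r z u v : kills N F r -> kills N F z ->
  connect (adj G F) u v -> r 0 v * z 0 v = r 0 u * z 0 u.
Proof.
move=> kr kz /connect_is_path[p pP].
by rewrite (kills_path NI kr pP) (kills_path NI kz pP) mulrACA sgn_sq mul1r.
Qed.

Lemma acyclic_bridge F i u v : cycles_of G F = set0 -> i \in F ->
  edge G i = [set u; v] -> ~~ connect (adj G (F :\ i)) u v.
Proof.
move=> F0 iF E; apply/negP => /connect_is_path[p pP].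
have iFi : i \notin F :\ i by rewrite !inE eqxx.
have : i |: path_edges G u p \in cycles_of G F.
  rewrite inE (cycle_of_path E iFi pP) subUset sub1set iF /=.
  by case/and3P: pP => /path_edges_sub sp _ _; apply: subset_trans sp (subD1set _ _).
by rewrite F0 inE.
Qed.

End HeadTail.

(** * Spanning trees of a balanced graph *)

Section Balanced.
Variables (R : realFieldType) (n m : nat) (G : sgraph n m) (N : 'M[R]_(n, m)).
Hypothesis NI : incidence G N.
Variable z : 'rV[R]_n.
Hypothesis z1 : forall v, z 0 v * z 0 v = 1.
Hypothesis kz : kills N setT z.
Implicit Types (F H C T : {set 'I_m}) (X : {set 'I_n}) (e i : 'I_m) (u v x j : 'I_n).
Implicit Types (r y : 'rV[R]_n).

Local Notation sg e := ((sigma G e)%:~R : R).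

Lemma potential_mul : (z^T)^T *m N = 0.
Proof. by rewrite trmxK; apply/rowP => e; rewrite kz ?inE // mxE. Qed.

Lemma potential_neq0 v : z 0 v != 0.
Proof. by apply/eqP => h; have /eqP := z1 v; rewrite h mul0r eq_sym oner_eq0. Qed.

Lemma kills_potential F : kills N F z.
Proof. exact: killsS (subsetT F) kz. Qed.

Lemma mul_potential r : (r *m z^T) 0 0 = \sum_v r 0 v * z 0 v.
Proof. by rewrite mxE; apply: eq_bigr => v _; rewrite mxE. Qed.

Lemma orth_projN r : (r *m orth_proj z^T) *m N = r *m N.
Proof. by rewrite -mulmxA mul_orth_proj // potential_mul. Qed.

Lemma potential_component_bridge F e u v : edge G e = [set u; v] ->
  ~~ connect (adj G (F :\ e)) u v ->
  (restrict (component G (F :\ e) u) z *m N) 0 e != 0.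
Proof.
move=> E cuv; apply/eqP => /(kills_edge NI _ E).
rewrite !mxE mem_component inE (negPf cuv) mulr0 => /eqP.
by rewrite (negPf (potential_neq0 u)).
Qed.

(** The products [r 0 v * z 0 v] are all equal and sum to zero. *)
Lemma tree_full T : connected_sub G setT T ->
  forall r, kills N T r -> r *m z^T = 0 -> r = 0.
Proof.
move=> conn r kr rz; apply/rowP => v; rewrite [RHS]mxE.
have /eqP : (r *m z^T) 0 0 = 0 by rewrite rz mxE.
rewrite mul_potential (eq_bigr (fun=> r 0 v * z 0 v)); last first.
  move=> u _; apply: (kills_ratio NI kr (@kills_potential T)).
  by move/forall_inP: conn => /(_ v (in_setT _))/forall_inP/(_ u (in_setT _)).
rewrite sumr_const card_ord mulrn_eq0 mulf_eq0 (negPf (potential_neq0 v)) orbF.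
by case/orP => [/eqP n0|/eqP //]; have := ltn_ord v; rewrite [X in (_ < X)%N]n0.
Qed.

Lemma spanning_tree_dual T : balanced G ->
  T \in spanning_trees G <-> exists Y, dual N z^T T Y.
Proof.
move=> bal; rewrite inE; split=> [/andP[conn /eqP T0]|[Y dY]].
  apply: dual_of_rows; last exact: tree_full.
  move=> i iT; have [a [b [E _]]] := edgeP G i.
  have cab := acyclic_bridge T0 iT E.
  (* The switching function on one side of the bridge [i]; projecting it makes it orthogonal to [z]
     without changing its product with [N]. *)
  exists (restrict (component G (T :\ i) a) z *m orth_proj z^T); split.
  - move=> e eT; rewrite orth_projN.
    exact: (kills_component NI _ (@kills_potential _)).
  - by rewrite orth_projN (potential_component_bridge E cab).
  - by rewrite -mulmxA orth_proj_ker mulmx0.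
apply/andP; split; last first.
  have [-> //|[C CT]] := set_0Vmem (cycles_of G T).
  case/negP: (dual_cycle_unbalanced NI dY CT).
  by move: CT; rewrite inE => /andP[cC _]; move/forallP/(_ C): bal; rewrite cC.
apply/forall_inP => u _; apply/forall_inP => v _; apply: contraT => uv.
have [_ _ _ full] := dY.
(* In a disconnected [T], the projection of this vector would vanish, making it a multiple of [z];
   but it is zero at [v] and nonzero at [u]. *)
pose r := restrict (component G T u) z.
have : r *m orth_proj z^T = 0.
  apply: full; last by rewrite -mulmxA orth_proj_ker mulmx0.
  by move=> e eT; rewrite orth_projN (kills_component NI _ (@kills_potential _)).
rewrite mulmxBr mulmx1 -scalemxAr mulmxA [r *m z^T]mx11_scalar mul_scalar_mx trmxK.
rewrite scalerA; set c := _ * _; move/eqP; rewrite subr_eq0 => /eqP rE.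
have := congr1 (fun A : 'rV_n => A 0 v) rE; rewrite /= !mxE inE (negPf uv).
move/esym/eqP; rewrite mulf_eq0 (negPf (potential_neq0 v)) orbF => /eqP c0.
have := congr1 (fun A : 'rV_n => A 0 u) rE; rewrite /= c0 scale0r !mxE mem_component.
by move/eqP; rewrite (negPf (potential_neq0 u)).
Qed.

(** Switching by [z] makes all edges positive, and the value at an edge becomes a difference up to
    sign. *)
Lemma mul_edge_potential r e u v : edge G e = [set u; v] ->
  (r *m N) 0 e * (r *m N) 0 e
    = (r 0 u * z 0 u - r 0 v * z 0 v) * (r 0 u * z 0 u - r 0 v * z 0 v).
Proof.
move=> E; have Nu := incidence_sq NI E.
have /(kills_edge NI _ E) zu : (z *m N) 0 e = 0 by apply: kz.
have ss := sg_sq R G e.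
rewrite (mul_edge_sg NI _ E).
transitivity ((r 0 u * (z 0 u * z 0 u) - sg e * r 0 v * (z 0 v * z 0 v))
              * (r 0 u * (z 0 u * z 0 u) - sg e * r 0 v * (z 0 v * z 0 v))).
  by rewrite !z1 mulrACA Nu !mulr1 mul1r.
transitivity ((z 0 u * z 0 u) * ((r 0 u * z 0 u - r 0 v * z 0 v)
    * (r 0 u * z 0 u - r 0 v * z 0 v))); last by rewrite z1 mul1r.
have -> : sg e * r 0 v * (z 0 v * z 0 v) = r 0 v * z 0 v * z 0 u by rewrite zu; ring.
by ring.
Qed.

(** After switching, the row takes one value on each side of [i], and the squared difference of the
    two values is 1. *)
Lemma tree_exchange F i k Y : balanced G -> i \notin F -> dual N z^T (i |: F) Y ->
  (Y *m N) i k != 0 -> (Y *m N) i k * (Y *m N) i k = 1.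
Proof.
move=> bal iF dY; rewrite -row_mulE => c0; set y := row i Y in c0 *.
have iT : i \in i |: F by rewrite setU11.
have ky : kills N F y by have := dual_kills dY iT; rewrite setU1K.
have /andP[conn _] : is_tree G setT (i |: F).
  by have := (spanning_tree_dual (i |: F) bal).2 (ex_intro _ Y dY); rewrite inE.
have [t [h [E _]]] := edgeP G i.
have := mul_edge_potential y E; rewrite (dual_diag dY iT) mulr1 => Ei.
have ratio x : y 0 x * z 0 x = y 0 t * z 0 t \/ y 0 x * z 0 x = y 0 h * z 0 h.
  have : connect (adj G (i |: F)) x t.
    by move/forall_inP: conn => /(_ x (in_setT _))/forall_inP/(_ t (in_setT _)).
  move/(connect_delete E); rewrite setU1K //.
  by case=> /(kills_ratio NI ky (@kills_potential F)) ->; [left|right].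
have [u [v [Ek _]]] := edgeP G k.
have c20 : (y *m N) 0 k * (y *m N) 0 k != 0 by rewrite mulf_neq0.
move: c20; rewrite (mul_edge_potential y Ek).
have [->|->] := ratio u; have [->|->] := ratio v.
- by rewrite subrr mulr0 eqxx.
- by move=> _; rewrite -Ei.
- by move=> _; rewrite -opprB mulrNN -Ei.
- by rewrite subrr mulr0 eqxx.
Qed.

Lemma mpinv_balanced : connected_graph G -> balanced G -> forall i j,
  mpinv N i j = (tau G)%:R^-1 * \sum_(T in spanning_trees G | i \in T)
    entry_at (mpinv (subcols N T)) i j.
Proof.
move=> conn bal i j.
rewrite (@mpinv_average _ _ _ N z^T (spanning_trees G) (fun=> 1) potential_mul) //.
- rewrite sumr_const; congr (_ * _).
  by apply: eq_bigr => T _; rewrite mul1r.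
- by move=> T; apply: spanning_tree_dual.
- have [|T [Y dY]] := @dual_exists _ _ _ N z^T.
    apply: tree_full; apply/forall_inP => u _; apply/forall_inP => v _.
    by move/forallP: conn => /(_ u)/forallP/(_ v).
  by exists T; apply/spanning_tree_dual => //; exists Y.
- by move=> F i' k Y iF _ _ dY c0; rewrite mul1r (tree_exchange bal iF dY c0).
Qed.

(** After switching, the row is constant on each side of [i]. Orthogonality to [z] and the value 1
    at [i] are two linear equations for the two constants. *)
Lemma tree_row T Y i (t := edge_tail G N i) (h := edge_head G N i) :
  (0 < n)%N -> is_tree G setT T -> dual N z^T T Y -> i \in T ->
  Y i t = weight G N i / n%:R * #|component G (T :\ i) h|%:R /\
  Y i h = weight G N i / n%:R * (- sg i * #|component G (T :\ i) t|%:R).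
Proof.
move=> n0 /andP[conn /eqP T0] dY iT.
set Th := component G _ h; set Tt := component G _ t.
have E : edge G i = [set t; h] := edge_tail_head G N i.
have cth := acyclic_bridge T0 iT E.
pose y := row i Y; have ky : kills N (T :\ i) y := dual_kills dY iT.
have ThC : Th = ~: Tt.
  apply/setP => v; rewrite in_setC; apply/idP/idP => [hv|].
    apply: contra cth; rewrite inE => tv; apply: connect_trans tv _.
    by rewrite adj_connect_sym; rewrite inE in hv.
  have : connect (adj G T) v t.
    by move/forall_inP: conn => /(_ v (in_setT _))/forall_inP/(_ t (in_setT _)).
  by move/(connect_delete E); rewrite !inE !(adj_connect_sym _ _ v) => -[->|].
have ratio w v : v \in component G (T :\ i) w -> y 0 v * z 0 v = y 0 w * z 0 w.
  by rewrite inE => /(kills_ratio NI ky (@kills_potential _)).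
have sum0 : y 0 t * z 0 t * #|Tt|%:R + y 0 h * z 0 h * #|Th|%:R = 0.
  rewrite !mulr_natr; have [_ _ Ys _] := dY.
  transitivity ((y *m z^T) 0 0); last by rewrite -row_mul Ys row0 mxE.
  rewrite mul_potential (bigID (mem Tt)) /=; congr (_ + _).
    by rewrite -sumr_const; apply: eq_bigr => v /ratio.
  rewrite -sumr_const; apply: eq_big => v; first by rewrite ThC inE.
  by move=> vT; rewrite (ratio h v) // -/Th ThC inE.
have cardn : #|Tt|%:R + #|Th|%:R = n%:R :> R.
  by rewrite -natrD ThC cardsC card_ord.
have n1 : n%:R != 0 :> R by rewrite pnatr_eq0 -lt0n.
have ny := dual_diag dY iT; rewrite (mul_tail_head NI) -/t -/h -/y in ny.
have /(kills_edge NI _ E) zt : (z *m N) 0 i = 0 by apply: kz.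
have ss := sg_sq R G i; have ww := weight_sq NI i; have zz := z1 h.
rewrite (_ : Y i t = y 0 t); last by rewrite mxE.
rewrite (_ : Y i h = y 0 h); last by rewrite mxE.
move: sum0 cardn n1 ny zt ss ww zz; move: (y 0 t) (y 0 h) (z 0 t) (z 0 h) (sg i).
move: (weight G N i) (#|Tt|%:R : R) (#|Th|%:R : R) (n%:R : R) => w a b k p q x x' s0.
move=> sum0 cardn n1 ny zt ss ww zz; subst x k.
(* With [z] eliminated, the system is [p - s0 * q = w] and [p * a + s0 * q * b = 0], where [a + b]
   stands for [n]. *)
have {}ny : p - s0 * q = w by rewrite -[LHS]mul1r -ww -mulrA ny mulr1.
have {}sum0 : s0 * p * a + q * b = 0.
  transitivity (x' * x' * (s0 * p * a + q * b)); first by rewrite zz mul1r.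
  transitivity (x' * (p * (s0 * x') * a + q * x' * b)); first by ring.
  by rewrite sum0 mulr0.
have {}sum0 : p * a + s0 * q * b = 0.
  transitivity (s0 * (s0 * p * a + q * b) + (1 - s0 * s0) * (p * a)); first by ring.
  by rewrite sum0 ss; ring.
split; apply: (mulIf n1).
  have -> : w / (a + b) * b * (a + b) = w * b by field.
  rewrite -ny; transitivity (p * a + s0 * q * b + (p - s0 * q) * b); first by ring.
  by rewrite sum0 add0r.
have -> : w / (a + b) * (- s0 * a) * (a + b) = w * (- s0 * a).
  by field.
rewrite -ny; transitivity (- s0 * (p - s0 * q) * a + s0 * (p * a + s0 * q * b)
   + (1 - s0 * s0) * (q * a + q * b)); first by ring.
by rewrite sum0 ss; ring.
Qed.

End Balanced.

(** * Entries of the inverse on a unicyclic component *)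

Section UnicyclicRows.
Variables (R : realFieldType) (n m : nat) (G : sgraph n m) (N : 'M[R]_(n, m)).
Hypothesis NI : incidence G N.
Variables (H : {set 'I_m}) (i : 'I_m) (X : {set 'I_n}) (C : {set 'I_m}) (Y : 'M[R]_(m, n)).
Hypotheses (dY : dual N 0 H Y) (iH : i \in H) (XH : X \in components G H).
Hypothesis (iX : edge G i \subset X).
Local Notation U := (edges_in G H X).
Hypothesis UC : cycles_of G U = [set C].
Implicit Types (u v x j : 'I_n).

Local Notation sg e := ((sigma G e)%:~R : R).
Local Notation t := (edge_tail G N i).
Local Notation h := (edge_head G N i).
Local Notation UK := (component_of_cycle G (U :\ i) C).

Let E : edge G i = [set t; h] := edge_tail_head G N i.
Let y : 'rV[R]_n := row i Y.

Lemma unicyclic_closed : closed_in G H X.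
Proof. by case/componentsP: XH => w ->; apply: component_closed. Qed.

Lemma unicyclic_cycle : is_cycle G C /\ C \subset U.
Proof. by apply/andP; have := set11 C; rewrite -UC inE. Qed.

Lemma unicyclic_unbalanced : ~~ balanced_cycle G C.
Proof.
apply: (dual_cycle_unbalanced NI dY); have [cC sC] := unicyclic_cycle.
by rewrite inE cC (subset_trans sC (edges_in_sub G H X)).
Qed.

Lemma unicyclic_kills : kills N (U :\ i) y.
Proof.
by apply: killsS (dual_kills dY iH); apply: setSD; apply: edges_in_sub.
Qed.

Lemma row_tail_head : y 0 t - sg i * y 0 h = weight G N i.
Proof.
have := dual_diag dY iH; rewrite (mul_tail_head NI) -/y => h1.
by rewrite -[RHS]mulr1 -[X in _ = _ * X]h1 mulrA (weight_sq NI) mul1r.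
Qed.

Lemma unicyclic_connect u v : u \in X -> v \in X -> connect (adj G U) u v.
Proof.
by move=> uX vX; move/forall_inP: (connected_component XH) => /(_ u uX)/forall_inP/(_ v vX).
Qed.

(** Both ends of [i] lie in [X], so the restriction of the row to [X] is again dual to [i] and
    equals the row. *)
Lemma row_outside j : j \notin X -> Y i j = 0.
Proof.
move=> jX; have kX : kills N (H :\ i) (restrict X y).
  apply: (kills_restrict NI); last by rewrite edges_inD1; apply: unicyclic_kills.
  by move=> e u v; rewrite in_setD1 => /andP[_]; apply: unicyclic_closed.
have : restrict X y - y = 0.
  have [_ _ _ full] := dY; apply: full; last by rewrite mulmx0.
  move=> e eH; rewrite mulmxBl mxE [X in _ + X]mxE.
  have [->|ei] := eqVneq e i; last first.
    by rewrite kX ?(dual_kills dY iH) ?in_setD1 ?ei // subrr.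
  move: iX; rewrite E subUset !sub1set => /andP[tX hX].
  by rewrite !(mul_edge NI _ E) !mxE tX hX subrr.
move/rowP/(_ j); rewrite !mxE (negPf jX) sub0r => /eqP.
by rewrite oppr_eq0 => /eqP.
Qed.

(** Going around the unbalanced cycle gives [y 0 t = - (sg i * y 0 h)]; with [row_tail_head] this
    makes [y 0 t] half the weight. *)
Lemma row_on_cycle j p : i \in C -> is_path G (U :\ i) t j p ->
  Y i j = weight G N i * (2%:R^-1 * (sgn G t p)%:~R).
Proof.
move=> iC pP; have [cC sC] := unicyclic_cycle.
have kC : kills N (C :\ i) y by apply: killsS unicyclic_kills; apply: setSD.
have := kills_cycle_edge NI cC iC E kC.
rewrite (prod_sigma_unbalanced unicyclic_unbalanced) rmorphN1 mulN1r => yt.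
have := kills_path NI unicyclic_kills pP; rewrite [LHS]mxE => ->.
have := row_tail_head; move: yt; move: (y 0 t) (sg i * y 0 h) => a b -> <-.
by field.
Qed.

(** Deleting [i] leaves the unbalanced cycle intact, which forces zero on its whole component. *)
Lemma row_cycle_side j : i \notin C -> j \in UK -> Y i j = 0.
Proof.
move=> iC; rewrite inE => /existsP[e /andP[eC /existsP[u /andP[ue uj]]]].
have [cC sC] := unicyclic_cycle.
have sCi : C \subset U :\ i by rewrite subsetD1 sC.
have y0 : y 0 u = 0.
  exact: (kills_unbalanced_cycle NI cC unicyclic_unbalanced sCi unicyclic_kills eC ue).
by have := kills_connect0 NI unicyclic_kills uj y0; rewrite mxE.
Qed.

Lemma cycle_side_closed u v : u \in UK -> connect (adj G (U :\ i)) u v -> v \in UK.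
Proof.
rewrite !inE => /existsP[e /andP[eC /existsP[w /andP[we wu]]]] uv.
apply/existsP; exists e; rewrite eC; apply/existsP; exists w; rewrite we.
exact: connect_trans wu uv.
Qed.

Lemma cycle_side_endpoint u v : i \notin C -> edge G i = [set u; v] ->
  u \notin UK -> v \in UK.
Proof.
move=> iC Ei uK; have [cC sC] := unicyclic_cycle.
have [e eC] := cycle_nonempty cC; have [x xe] := edge_ne G e.
have xX : x \in X.
  by have := subsetP sC _ eC; rewrite inE => /andP[_ /subsetP]; apply.
have uX : u \in X by apply: (subsetP iX); rewrite Ei !inE eqxx.
have xK : x \in UK.
  rewrite inE; apply/existsP; exists e; rewrite eC; apply/existsP; exists x.
  by rewrite xe connect0.
have [xu|xv] := connect_delete Ei (unicyclic_connect xX uX).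
  by case/negP: uK; apply: cycle_side_closed xu.
exact: cycle_side_closed xv.
Qed.

(** The end of [i] on the cycle side has value zero, so [row_tail_head] gives the value at the other
    end: the weight at a tail, [- sg i] times it at a head. *)
Lemma row_tree_side j p : i \notin C -> j \notin UK -> path_to_edge G U i j p ->
  (last j p = t /\ h \in UK /\ Y i j = weight G N i * (sgn G j p)%:~R) \/
  (last j p = h /\ t \in UK /\ Y i j = weight G N i * (- sg i * (sgn G j p)%:~R)).
Proof.
move=> iC jK pP; have jl := path_to_edge_connect pP.
have lK : last j p \notin UK.
  by apply: contra jK => lK; apply: cycle_side_closed lK _; rewrite adj_connect_sym.
have := kills_path_to_edge NI unicyclic_kills pP; rewrite [LHS]mxE => ->.
have rE := row_tail_head.
have [lE|lE] := path_to_edge_last N pP; [left|right]; rewrite lE in lK *; split=> //.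
  have hK := cycle_side_endpoint iC E lK; split=> //.
  have := row_cycle_side iC hK; move: rE; rewrite !mxE => rE h0.
  by rewrite -rE h0 mulr0 subr0 mulrC.
have tK : t \in UK by apply: cycle_side_endpoint iC _ lK; rewrite E setUC.
split=> //; have := row_cycle_side iC tK; move: rE; rewrite !mxE => rE t0.
rewrite -rE t0 sub0r.
transitivity ((sg i * sg i) * ((sgn G j p)%:~R * Y i h)); last by ring.
by rewrite sg_sq mul1r.
Qed.

End UnicyclicRows.

Theorem theorem4p1 (R : realFieldType) (n m : nat) (G : sgraph n m)
    (N : 'M[R]_(n, m)) :
  (2 <= n)%N -> connected_graph G -> incidence G N ->
  (balanced G ->
    (forall (i : 'I_m) (j : 'I_n),
      mpinv N i j =
        (tau G)%:R^-1 * \sum_(T in spanning_trees G | i \in T)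
                           entry_at (mpinv (subcols N T)) i j) /\
    (forall (T : {set 'I_m}) (i : 'I_m) (j : 'I_n) (p : seq 'I_n),
      T \in spanning_trees G -> i \in T -> shortest_to_edge G T i j p ->
      let Th := component G (T :\ i) (edge_head G N i) in
      let Tt := component G (T :\ i) (edge_tail G N i) in
      let a := weight G N i * (sgn G j p)%:~R / n%:R in
      (j \in Tt ->
        entry_at (mpinv (subcols N T)) i j = a * #|Th|%:R) /\
      (j \in Th ->
        entry_at (mpinv (subcols N T)) i j
          = a * (- (sigma G i)%:~R * #|Tt|%:R)))) /\
  (~~ balanced G ->
    (forall (i : 'I_m) (j : 'I_n),
      mpinv N i j =
        (\sum_(H in TU G) 4%:R ^+ num_unicyclic G H)^-1 *
        \sum_(H in TU G | i \in H)
           4%:R ^+ num_unicyclic G H * entry_at (sqinv (subcols N H)) i j) /\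
    (forall H : {set 'I_m}, H \in TU G ->
      subcols N H *m sqinv (subcols N H) = 1%:M /\
      sqinv (subcols N H) *m subcols N H = 1%:M) /\
    (forall (H : {set 'I_m}) (i : 'I_m) (X : {set 'I_n}) (C : {set 'I_m}),
      H \in TU G -> i \in H ->
      X \in components G H -> edge G i \subset X ->
      let U := edges_in G H X in
      cycles_of G U = [set C] ->
      let UC := component_of_cycle G (U :\ i) C in
      let Uh := component G (U :\ i) (edge_head G N i) in
      forall j : 'I_n,
      let x := entry_at (sqinv (subcols N H)) i j in
      (j \notin X -> x = 0) /\
      (j \in X ->
        [/\ i \in C ->
              forall p, is_path G (U :\ i) (edge_tail G N i) j p ->
              x = weight G N i * (2%:R^-1 * (sgn G (edge_tail G N i) p)%:~R),
            i \notin C -> j \in UC -> x = 0,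
            i \notin C -> j \notin UC -> sigma G i = 1 -> j \in Uh ->
              forall p, shortest_to_edge G U i j p ->
              x = weight G N i * - (sgn G j p)%:~R
          & i \notin C -> j \notin UC -> ~ (sigma G i = 1 /\ j \in Uh) ->
              forall p, shortest_to_edge G U i j p ->
              x = weight G N i * (sgn G j p)%:~R]))).
Proof.
move=> n2 conn NI; split=> [bal|ub].
  have [C|z z1 kz] := potential_exists NI (F := setT).
    by rewrite inE => /andP[cC _]; move/forallP/(_ C): bal; rewrite cC.
  split=> [|T i j p TG iT [pP _] Th Tt a]; first exact: (mpinv_balanced NI z1 kz).
  have [Y dY] := (spanning_tree_dual NI z1 kz T bal).1 TG.
  have tT : is_tree G setT T by rewrite inE in TG.
  have [rt rh] := tree_row NI z1 kz (ltnW n2) tT dY iT.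
  rewrite (entry_at_mpinv _ _ (potential_mul kz) dY).
  have /andP[_ /eqP T0] := tT.
  have cth := acyclic_bridge T0 iT (edge_tail_head G N i).
  have jl := path_to_edge_connect pP.
  have := kills_path_to_edge NI (dual_kills dY iT) pP; rewrite !mxE => ->.
  rewrite /a !inE; split=> jT.
    (* A path from the tail side cannot end at the head, because [i] is a bridge of the tree. *)
    have [->|lE] := path_to_edge_last N pP; first by rewrite rt; ring.
    by case/negP: cth; apply: connect_trans jT _; rewrite -lE.
  have [lE|->] := path_to_edge_last N pP; last by rewrite rh; ring.
  case/negP: cth; rewrite adj_connect_sym; apply: connect_trans jT _.
  by rewrite -lE.
split; first exact: mpinv_unbalanced.
split=> [H /(TU_dual NI)[Y dY]|]; first by have [] := dual0_sqinv dY.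
move=> H i X C /(TU_dual NI)[Y dY] iH XH iX U UC UK Uh j x.
have -> : x = Y i j.
  rewrite /x; have [-> _ _] := dual0_sqinv dY.
  by rewrite entry_at_subrows //; case: dY.
split=> [|jX]; first exact: (row_outside NI dY iH XH iX).
have tree := row_tree_side NI dY iH XH iX UC.
split=> [iC p|iC jK|iC jK s1 jh p [pP _]|iC jK nh p [pP _]].
- exact: (row_on_cycle NI dY iH UC).
- exact: (row_cycle_side NI dY iH UC).
(* A path ending at the tail would put the head, and with it [j], on the cycle side. *)
- have [[lE [hK _]]|[_ [_ ->]]] := tree j p iC jK pP; last by rewrite s1 mulN1r.
  case/negP: jK; apply: cycle_side_closed hK _.
  by rewrite inE in jh.
have [[_ [_ //]]|[lE [_ ->]]] := tree j p iC jK pP.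
(* At the head, a negative edge has [- sg i = 1], and a positive one would place [j] in [Uh]. *)
case: (sigmaP G i) => s; last by rewrite s rmorphN1 opprK mul1r.
case: nh; split=> //; rewrite inE adj_connect_sym -lE; exact: path_to_edge_connect pP.
Qed.
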